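(* Let $G$ be a groupoid acting by isomorphisms on a Fell bundle $p:\mathscr{A}\to H$ over a groupoid $H$. Then every ideal of the semidirect-product Fell bundle $\mathscr{A}\propto G$ is of the form $\mathscr{I}\propto G$ for a $G$-invariant ideal $\mathscr{I}$ of $\mathscr{A}$, and the map $\mathscr{I}\mapsto \mathscr{I}\propto G$ is a lattice isomorphism from the lattice of $G$-invariant ideals of $\mathscr{A}$ onto the lattice of all ideals of $\mathscr{A}\propto G$.
   Context: All groupoids are locally compact Hausdorff with open range and source maps $r,s$; $G^{(0)}$ is the unit space. Banach bundles may have a norm that is only upper semicontinuous. Fell bundle. A Fell bundle $p:\mathscr{B}\to G$ over a groupoid $G$ is a Banach bundle with a continuous, fibrewise bilinear, associative multiplication $(b,c)\mapsto bc$ defined on $\mathscr{B}^{(2)}=\{(b,c): s(p(b))=r(p(c))\}$ with $p(bc)=p(b)p(c)$ and $\|bc\|\le\|b\|\|c\|$, and a continuous, fibrewise conjugate-linear involution $b\mapsto b^*$ with $p(b^* )=p(b)^{-1}$, $(bc)^*=c^*b^*$, $b^{**}=b$, such that each fibre $B_u$ ($u\in G^{(0)}$) is a $C^*$-algebra and each fibre $B_x$ is a $B_{r(x)}$--$B_{s(x)}$ imprimitivity bimodule with inner products $bc^*$ (left) and $b^*c$ (right). (In particular all Fell bundles are saturated.) Ideals. A Fell subbundle of $\mathscr{B}$ is a subset meeting each fibre in a closed linear subspace, which is a Banach bundle in the relative topology and is closed under multiplication and involution. An ideal of $\mathscr{B}$ is a Fell subbundle $\mathscr{I}$ such that $bc\in\mathscr{I}$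 whenever $(b,c)\in\mathscr{B}^{(2)}$ and either $b\in\mathscr{I}$ or $c\in\mathscr{I}$. Ideals are ordered by inclusion. Actions by isomorphisms. $G$ acts on the groupoid $H$ by isomorphisms if $G$ acts continuously on the left of the space $H$ with continuous moment map $\rho:H\to G^{(0)}$ satisfying $\rho(h)=\rho(r(h))=\rho(s(h))$, and for each $x\in G$ the map $h\mapsto x\cdot h$ is a groupoid isomorphism of $H_{s(x)}$ onto $H_{r(x)}$, where $H_u=\rho^{-1}(u)$. $G$ acts by isomorphisms on a Fell bundle $p:\mathscr{A}\to H$ if $G$ acts by isomorphisms on $H$ and there is a continuous left action of $G$ on $\mathscr{A}$ with moment map $\rho\circ p$ such that $p(x\cdot a)=x\cdot p(a)$, each map $a\mapsto x\cdot a$ is linear and isometric on fibres, $x\cdot(ab)=(x\cdot a)(x\cdot b)$ and $(x\cdot a)^*=x\cdot a^*$. An ideal $\mathscr{I}$ of $\mathscr{A}$ is $G$-invariant if $x\cdot i\in\mathscr{I}$ whenever $i\in\mathscr{I}$ and $s(x)=\rho(p(i))$. Semidirect products. The semidirect product groupoid is $H\propto G=\{(h,x)\in H\times G:\rho(h)=r(x)\}$ with $(h,x)(k,y)=(h(x\cdot k),xy)$ when $s(x)=r(y)$ and $s(h)=x\cdot r(k)$, and $(h,x)^{-1}=(x^{-1}\cdot h^{-1},x^{-1})$. The semidirect-product Fell bundle is $\mathscr{A}\propto G=\{(a,x)\in\mathscr{A}\times G:\rho(p(a))=r(x)\}$ over $H\propto G$, with projection $(a,x)\mapsto(p(a),x)$,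 norm $\|(a,x)\|=\|a\|$, operations $(a,x)(b,y)=(a(x\cdot b),xy)$ and $(a,x)^*=(x^{-1}\cdot a^*,x^{-1})$. For a $G$-invariant ideal $\mathscr{I}$ of $\mathscr{A}$, $\mathscr{I}\propto G=\{(i,x)\in\mathscr{A}\propto G: i\in\mathscr{I}\}$. *)

(* Defs.v *)
From HB Require Import structures.
From mathcomp Require Import all_boot all_order all_algebra.
From mathcomp Require Import all_classical all_reals topology normedtype.
From mathcomp Require Import complex.

Set Implicit Arguments.
Unset Strict Implicit.
Unset Printing Implicit Defensive.

Import Order.TTheory GRing.Theory Num.Theory.
Import numFieldNormedType.Exports.

Local Open Scope classical_set_scope.
Local Open Scope ring_scope.
Local Open Scope complex_scope.

(* Units are arrows: the unit space is [set u | rng u = u]. *)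
Record groupoid := Groupoid {
  arr :> topologicalType ;
  rng : arr -> arr ;
  src : arr -> arr ;
  gmul : forall x y : arr, src x = rng y -> arr ;
  ginv : arr -> arr ;
  rng_mul : forall (x y : arr) (e : src x = rng y), rng (gmul e) = rng x ;
  src_mul : forall (x y : arr) (e : src x = rng y), src (gmul e) = src y ;
  gmulA : forall (x y z : arr) (exy : src x = rng y) (eyz : src y = rng z)
    (el : src (gmul exy) = rng z) (er : src x = rng (gmul eyz)),
    gmul el = gmul er ;
  rng_rng : forall x : arr, rng (rng x) = rng x ;
  src_rng : forall x : arr, src (rng x) = rng x ;
  rng_src : forall x : arr, rng (src x) = src x ;
  src_src : forall x : arr, src (src x) = src x ;
  gmul1l : forall (x : arr) (e : src (rng x) = rng x), gmul e = x ;
  gmul1r : forall (x : arr) (e : src x = rng (src x)), gmul e = x ;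
  rng_inv : forall x : arr, rng (ginv x) = src x ;
  src_inv : forall x : arr, src (ginv x) = rng x ;
  gmulV : forall (x : arr) (e : src x = rng (ginv x)), gmul e = rng x ;
  gmulVl : forall (x : arr) (e : src (ginv x) = rng x), gmul e = src x }.

Definition units (G : groupoid) : set G := [set u | rng u = u].

(* gprod x y z : the product xy is defined and equals z.  Multiplication of
   fibres B x, B y below lands in B z for any such z, which avoids transports
   along equalities of arrows. *)
Definition gprod (G : groupoid) (x y z : G) : Prop :=
  exists e : src x = rng y, gmul e = z.

Definition gcomposable (G : groupoid) : set (G * G) :=
  [set xy | src xy.1 = rng xy.2].

Definition cmul (G : groupoid) (xy : @gcomposable G) : G := gmul (set_valP xy).

Record lch_groupoid (G : groupoid) : Prop := LchGroupoid {
  lch_hausdorff : hausdorff_space G ;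
  lch_compact : locally_compact [set: G] ;
  lch_mul : continuous (@cmul G) ;
  lch_inv : continuous (@ginv G) ;
  lch_rng : continuous (@rng G) ;
  lch_src : continuous (@src G) ;
  (* openness of the maps onto the unit space in its relative topology *)
  lch_rng_open : forall U : set G, open U ->
    exists2 V, open V & [set rng x | x in U] = V `&` @units G ;
  lch_src_open : forall U : set G, open U ->
    exists2 V, open V & [set src x | x in U] = V `&` @units G }.

Section groupoid_lemmas.
Variable G : groupoid.
Implicit Types x y z u : G.

Lemma gmul_congr x x' y y' (e : src x = rng y) (e' : src x' = rng y') :
  x = x' -> y = y' -> gmul e = gmul e'.
Proof.
by move=> ex ey; subst x' y'; congr gmul; apply: Prop_irrelevance.
Qed.

Lemma gprod_fun x y z z' : gprod x y z -> gprod x y z' -> z = z'.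
Proof. by move=> [e <-] [e' <-]; apply: gmul_congr. Qed.

Lemma gprod_l x : gprod (rng x) x x.
Proof. by exists (src_rng x); apply: gmul1l. Qed.

Lemma gprod_r x : gprod x (src x) x.
Proof. by exists (esym (rng_src x)); apply: gmul1r. Qed.

Lemma gprod_V x : gprod x (ginv x) (rng x).
Proof. by exists (esym (rng_inv x)); apply: gmulV. Qed.

Lemma gprod_Vl x : gprod (ginv x) x (src x).
Proof. by exists (src_inv x); apply: gmulVl. Qed.

Lemma gprod_unit u : units u -> gprod u u u.
Proof. by rewrite /units /= => eu; have := gprod_l u; rewrite eu. Qed.

Lemma inv_unit u : units u -> ginv u = u.
Proof.
rewrite /units /= => eu.
have su : src u = u by rewrite -eu src_rng.
have := gprod_l (ginv u); rewrite rng_inv su => c.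
by have := gprod_fun c (gprod_V u); rewrite eu.
Qed.

Lemma units_rng x : units (rng x).
Proof. exact: rng_rng. Qed.

Lemma units_src x : units (src x).
Proof. exact: rng_src. Qed.

Lemma gprodA x y z xy yz w : gprod x y xy -> gprod y z yz -> gprod xy z w ->
  gprod x yz w.
Proof.
move=> [e <-] [e' <-] [e'' <-].
have er : src x = rng (gmul e') by rewrite rng_mul.
by exists er; rewrite (gmulA e'' er).
Qed.

Lemma gprod_idl x y : gprod x y y -> x = rng y.
Proof.
move=> c; have [e _] := c.
have := gprodA c (gprod_V y) (gprod_V y).
by rewrite -e => c'; apply: gprod_fun (gprod_r x) c'.
Qed.

Lemma gprod_idr x y : gprod x y x -> y = src x.
Proof.
move=> [e c].
have ey : gprod (ginv x) x (rng y) by rewrite -e; apply: gprod_Vl.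
have c1 : gprod x y x by exists e.
have := gprodA ey c1; move=> /(_ _ (gprod_l y)) c2.
exact: gprod_fun c2 (gprod_Vl x).
Qed.

End groupoid_lemmas.

(* A point of the total space of a family of fibres over X.  (Not sigT, whose
   canonical topology is the disjoint union.) *)
Record total_space (X : Type) (F : X -> Type) :=
  TotalSpace { base : X ; vec : F base }.

Record bundle (R : realType) (X : topologicalType) := Bundle {
  fib :> X -> completeNormedModType R[i] ;
  bopen : set (set (total_space fib)) ;
  bopenT : bopen setT ;
  bopenI : setI_closed bopen ;
  bopen_bigU : forall (I : Type) (f : I -> set (total_space fib)),
    (forall i, bopen (f i)) -> bopen (\bigcup_i f i) }.

Definition tot (R : realType) (X : topologicalType) (B : bundle R X) : Type :=
  total_space (fib B).

Definition Pt (R : realType) (X : topologicalType) (B : bundle R X) (x : X)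
  (v : B x) : tot B := @TotalSpace X (fib B) x v.

HB.instance Definition _ (R : realType) (X : topologicalType) (B : bundle R X) :=
  gen_eqMixin (tot B).
HB.instance Definition _ (R : realType) (X : topologicalType) (B : bundle R X) :=
  gen_choiceMixin (tot B).
HB.instance Definition _ (R : realType) (X : topologicalType) (B : bundle R X) :=
  isOpenTopological.Build (tot B) (@bopenT R X B) (@bopenI R X B)
    (@bopen_bigU R X B).

Definition tnorm (R : realType) (X : topologicalType) (B : bundle R X)
  (b : tot B) : R[i] := `|vec b|.

Definition same_fibre (R : realType) (X : topologicalType) (B : bundle R X) :
  set (tot B * tot B) := [set bc | base bc.1 = base bc.2].

Definition fibre_add (R : realType) (X : topologicalType) (B : bundle R X)
    (b c : tot B) (e : base b = base c) : tot B :=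
  Pt (ecast x (B x) e (vec b) + vec c).

Definition tadd (R : realType) (X : topologicalType) (B : bundle R X)
    (bc : @same_fibre R X B) : tot B := fibre_add (set_valP bc).

(* Fibrewise addition is defined on the pairs of points over the same base point,
   multiplication (tmul) on those over composable arrows; both domains carry the
   relative topology of the product of total spaces.

   The set I, with the topology, linear structure and norm of B, is an upper
   semicontinuous Banach bundle over X.  For I = setT this says that B itself
   is one; the completeness of the fibres of I is that of closed subspaces. *)
Record banach_bundle_on (R : realType) (X : topologicalType) (B : bundle R X)
    (I : set (tot B)) : Prop := BanachBundleOn {
  bb_zero : forall x : X, I (Pt (0 : B x)) ;
  bb_linear : forall (x : X) (k : R[i]) (a b : B x),
    I (Pt a) -> I (Pt b) -> I (Pt (k *: a + b)) ;
  bb_closed : forall x : X, closed [set a : B x | I (Pt a)] ;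
  bb_proj_continuous : {within I, continuous (fun b : tot B => base b)} ;
  bb_proj_open : forall U : set (tot B), open U ->
    open [set base b | b in U `&` I] ;
  bb_proj_surj : forall x : X, exists2 b : tot B, I b & base b = x ;
  bb_norm_usc : forall e : R[i],
    open ([set b : tot B | tnorm b < e] : set (subspace I)) ;
  bb_add_continuous :
    {within [set bc : @same_fibre R X B | I (val bc).1 /\ I (val bc).2],
      continuous (@tadd R X B)} ;
  bb_scale_continuous : forall k : R[i],
    {within I, continuous (fun b : tot B => Pt (k *: vec b) : tot B)} ;
  bb_norm0 : forall (F : set_system (tot B)) (x : X), ProperFilter F -> F I ->
    (fun b : tot B => base b) @ F --> x ->
    (forall e : R[i], 0 < e -> \forall b \near F, tnorm b < e) ->
    F --> (Pt (0 : B x) : tot B) }.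

Definition bilinear_map (R : realType) (U V W : completeNormedModType R[i])
    (m : U -> V -> W) : Prop :=
  (forall (k : R[i]) (u u' : U) (v : V),
      m (k *: u + u') v = k *: m u v + m u' v) /\
  (forall (k : R[i]) (u : U) (v v' : V),
      m u (k *: v + v') = k *: m u v + m u v').

Definition conj_linear (R : realType) (U V : completeNormedModType R[i])
    (f : U -> V) : Prop :=
  forall (k : R[i]) (u u' : U), f (k *: u + u') = k^* *: f u + f u'.

Record cstar_algebra (R : realType) (A : completeNormedModType R[i])
    (mul : A -> A -> A) (star : A -> A) : Prop := CstarAlgebra {
  cs_bilinear : bilinear_map mul ;
  cs_mulA : associative mul ;
  cs_norm_mul : forall a b : A, `|mul a b| <= `|a| * `|b| ;
  cs_conj_linear : conj_linear star ;
  cs_star_mul : forall a b : A, star (mul a b) = mul (star b) (star a) ;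
  cs_starK : involutive star ;
  cs_norm : forall a : A, `|mul (star a) a| = `|a| ^+ 2 }.

(* Positive elements of a C*-algebra, as those of the form c^*c. *)
Definition cs_pos (R : realType) (A : completeNormedModType R[i])
    (mul : A -> A -> A) (star : A -> A) : set A :=
  [set a | exists c : A, a = mul (star c) c].

Definition full_pairing (R : realType) (A X : completeNormedModType R[i])
    (ip : X -> X -> A) : Prop :=
  closure [set a : A | exists (n : nat) (k : 'I_n -> R[i]) (f g : 'I_n -> X),
    a = \sum_(i < n) k i *: ip (f i) (g i)] = setT.

(* A full left Hilbert module, its norm being the one X comes with. *)
Record left_hilbert_module (R : realType) (A X : completeNormedModType R[i])
    (mul : A -> A -> A) (star : A -> A) (act : A -> X -> X) (ip : X -> X -> A) :
    Prop := LeftHilbertModule {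
  lh_bilinear : bilinear_map act ;
  lh_act_mul : forall (a b : A) (x : X), act (mul a b) x = act a (act b x) ;
  lh_ip_linear : forall (k : R[i]) (x x' y : X),
    ip (k *: x + x') y = k *: ip x y + ip x' y ;
  lh_ip_act : forall (a : A) (x y : X), ip (act a x) y = mul a (ip x y) ;
  lh_ip_star : forall x y : X, star (ip x y) = ip y x ;
  lh_ip_pos : forall x : X, cs_pos mul star (ip x x) ;
  lh_ip_eq0 : forall x : X, ip x x = 0 -> x = 0 ;
  lh_norm : forall x : X, `|x| ^+ 2 = `|ip x x| ;
  lh_full : full_pairing ip }.

Record right_hilbert_module (R : realType) (A X : completeNormedModType R[i])
    (mul : A -> A -> A) (star : A -> A) (act : X -> A -> X) (ip : X -> X -> A) :
    Prop := RightHilbertModule {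
  rh_bilinear : bilinear_map act ;
  rh_act_mul : forall (x : X) (a b : A), act x (mul a b) = act (act x a) b ;
  rh_ip_linear : forall (k : R[i]) (x y y' : X),
    ip x (k *: y + y') = k *: ip x y + ip x y' ;
  rh_ip_act : forall (x y : X) (a : A), ip x (act y a) = mul (ip x y) a ;
  rh_ip_star : forall x y : X, star (ip x y) = ip y x ;
  rh_ip_pos : forall x : X, cs_pos mul star (ip x x) ;
  rh_ip_eq0 : forall x : X, ip x x = 0 -> x = 0 ;
  rh_norm : forall x : X, `|x| ^+ 2 = `|ip x x| ;
  rh_full : full_pairing ip }.

Record imprimitivity_bimodule (R : realType) (A B X : completeNormedModType R[i])
    (mulA : A -> A -> A) (starA : A -> A) (mulB : B -> B -> B) (starB : B -> B)
    (lact : A -> X -> X) (ract : X -> B -> X)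
    (lip : X -> X -> A) (rip : X -> X -> B) : Prop := ImprimitivityBimodule {
  ib_left : left_hilbert_module mulA starA lact lip ;
  ib_right : right_hilbert_module mulB starB ract rip ;
  ib_rip_lact : forall (a : A) (x y : X),
    rip (lact a x) y = rip x (lact (starA a) y) ;
  ib_lip_ract : forall (b : B) (x y : X),
    lip (ract x b) y = lip x (ract y (starB b)) ;
  ib_assoc : forall x y z : X, lact (lip x y) z = ract x (rip y z) }.

Record fell (R : realType) (G : groupoid) := Fell {
  fbundle :> bundle R G ;
  fmul : forall x y z : G, gprod x y z ->
    fbundle x -> fbundle y -> fbundle z ;
  fstar : forall x y : G, ginv x = y -> fbundle x -> fbundle y }.

Definition tcomposable (R : realType) (G : groupoid) (B : fell R G) :
  set (tot B * tot B) := [set bc | src (base bc.1) = rng (base bc.2)].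

Definition fibre_mul (R : realType) (G : groupoid) (B : fell R G) (b c : tot B)
    (e : src (base b) = rng (base c)) : tot B :=
  Pt (fmul (ex_intro _ e erefl : gprod (base b) (base c) (gmul e))
        (vec b) (vec c)).

Definition tmul (R : realType) (G : groupoid) (B : fell R G)
    (bc : @tcomposable R G B) : tot B := fibre_mul (set_valP bc).

Definition tstar (R : realType) (G : groupoid) (B : fell R G) (b : tot B) :
  tot B := Pt (fstar (erefl (ginv (base b))) (vec b)).

Definition unit_mul (R : realType) (G : groupoid) (B : fell R G) (u : G)
    (hu : units u) : B u -> B u -> B u := fmul (gprod_unit hu).

Definition unit_star (R : realType) (G : groupoid) (B : fell R G) (u : G)
    (hu : units u) : B u -> B u := fstar (inv_unit hu).

Definition left_ip (R : realType) (G : groupoid) (B : fell R G) (x : G)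
    (b c : B x) : B (rng x) := fmul (gprod_V x) b (fstar erefl c).

Definition right_ip (R : realType) (G : groupoid) (B : fell R G) (x : G)
    (b c : B x) : B (src x) := fmul (gprod_Vl x) (fstar erefl b) c.

Record fell_bundle (R : realType) (G : groupoid) (B : fell R G) : Prop :=
    FellBundle {
  fb_banach : banach_bundle_on (setT : set (tot B)) ;
  fb_mul_continuous : continuous (@tmul R G B) ;
  fb_mul_bilinear : forall (x y z : G) (c : gprod x y z),
    bilinear_map (@fmul R G B x y z c) ;
  fb_mulA : forall (x y z xy yz w : G) (cxy : gprod x y xy) (cyz : gprod y z yz)
    (cl : gprod xy z w) (cr : gprod x yz w) (a : B x) (b : B y) (d : B z),
    fmul cl (fmul cxy a b) d = fmul cr a (fmul cyz b d) ;
  fb_norm_mul : forall (x y z : G) (c : gprod x y z) (a : B x) (b : B y),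
    `|fmul c a b| <= `|a| * `|b| ;
  fb_star_continuous : continuous (@tstar R G B) ;
  fb_star_conj_linear : forall (x y : G) (e : ginv x = y),
    conj_linear (@fstar R G B x y e) ;
  fb_star_mul : forall (x y z x' y' z' : G) (c : gprod x y z)
    (ex : ginv x = x') (ey : ginv y = y') (ez : ginv z = z')
    (c' : gprod y' x' z') (a : B x) (b : B y),
    fstar ez (fmul c a b) = fmul c' (fstar ey b) (fstar ex a) ;
  fb_starK : forall (x y : G) (e : ginv x = y) (e' : ginv y = x) (a : B x),
    fstar e' (fstar e a) = a ;
  fb_cstar : forall (u : G) (hu : units u),
    cstar_algebra (@unit_mul R G B u hu) (@unit_star R G B u hu) ;
  fb_imprimitivity : forall x : G,
    imprimitivity_bimodule
      (@unit_mul R G B (rng x) (units_rng x))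
      (@unit_star R G B (rng x) (units_rng x))
      (@unit_mul R G B (src x) (units_src x))
      (@unit_star R G B (src x) (units_src x))
      (@fmul R G B (rng x) x x (gprod_l x))
      (@fmul R G B x (src x) x (gprod_r x))
      (@left_ip R G B x) (@right_ip R G B x) }.

Record fell_subbundle (R : realType) (G : groupoid) (B : fell R G)
    (I : set (tot B)) : Prop := FellSubbundle {
  fs_banach : banach_bundle_on I ;
  fs_mul : forall bc : @tcomposable R G B,
    I (val bc).1 -> I (val bc).2 -> I (tmul bc) ;
  fs_star : forall b : tot B, I b -> I (tstar b) }.

Record ideal (R : realType) (G : groupoid) (B : fell R G) (I : set (tot B)) :
    Prop := Ideal {
  id_subbundle : fell_subbundle I ;
  id_absorb : forall bc : @tcomposable R G B,
    I (val bc).1 \/ I (val bc).2 -> I (tmul bc) }.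

Definition act_domain (G H : groupoid) (rho : H -> G) : set (G * H) :=
  [set xh | src xh.1 = rho xh.2].

(* In ia_hom, x acts as a functor on the subgroupoid of h with rho h = src x;
   it is an isomorphism onto that of h with rho h = rng x because ginv x acts
   as the inverse functor. *)
Record iso_action (G H : groupoid) := IsoAction {
  rho : H -> G ;
  act : forall (x : G) (h : H), src x = rho h -> H ;
  rho_units : forall h : H, units (rho h) ;
  rho_continuous : continuous rho ;
  rho_rng : forall h : H, rho (rng h) = rho h ;
  rho_src : forall h : H, rho (src h) = rho h ;
  act_continuous :
    continuous (fun xh : act_domain rho => act (set_valP xh)) ;
  rho_act : forall (x : G) (h : H) (e : src x = rho h), rho (act e) = rng x ;
  act1 : forall (h : H) (e : src (rho h) = rho h), act e = h ;
  actM : forall (x y : G) (h : H) (exy : src x = rng y)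
    (eh : src (gmul exy) = rho h) (ey : src y = rho h)
    (ex : src x = rho (act ey)), act eh = act ex ;
  ia_hom : forall (x : G) (h k l : H) (eh : src x = rho h) (ek : src x = rho k)
    (el : src x = rho l), gprod h k l -> gprod (act eh) (act ek) (act el) }.

(* acts alpha x h k : the arrow x.h is defined and equals k. *)
Definition acts (G H : groupoid) (alpha : iso_action G H) (x : G) (h k : H) :
  Prop := exists e : src x = rho alpha h, act e = k.

Definition tact_domain (R : realType) (G H : groupoid) (alpha : iso_action G H)
    (A : fell R H) : set (G * tot A) :=
  [set xa | src xa.1 = rho alpha (base xa.2)].

Definition tact_map (R : realType) (G H : groupoid) (alpha : iso_action G H)
    (A : fell R H) (f : forall (x : G) (h k : H), acts alpha x h k -> A h -> A k)
    (xa : @tact_domain R G H alpha A) : tot A :=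
  Pt (f _ _ _ (ex_intro _ (set_valP xa) erefl) (vec (val xa).2)).

Record fell_action (R : realType) (G H : groupoid) (alpha : iso_action G H)
    (A : fell R H) := FellAction {
  fact : forall (x : G) (h k : H), acts alpha x h k -> A h -> A k ;
  fact_continuous : continuous (tact_map fact) ;
  fact1 : forall (h : H) (c : acts alpha (rho alpha h) h h) (a : A h),
    fact c a = a ;
  factM : forall (x y z : G) (h k l : H) (cxy : gprod x y z)
    (cy : acts alpha y h k) (cx : acts alpha x k l) (cz : acts alpha z h l)
    (a : A h), fact cz a = fact cx (fact cy a) ;
  fact_linear : forall (x : G) (h k : H) (c : acts alpha x h k) (s : R[i])
    (a b : A h), fact c (s *: a + b) = s *: fact c a + fact c b ;
  fact_norm : forall (x : G) (h k : H) (c : acts alpha x h k) (a : A h),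
    `|fact c a| = `|a| ;
  fact_mul : forall (x : G) (h k l h' k' l' : H) (c : gprod h k l)
    (c' : gprod h' k' l') (ch : acts alpha x h h') (ck : acts alpha x k k')
    (cl : acts alpha x l l') (a : A h) (b : A k),
    fact cl (fmul c a b) = fmul c' (fact ch a) (fact ck b) ;
  fact_star : forall (x : G) (h k h' k' : H) (e : ginv h = k)
    (e' : ginv h' = k') (ch : acts alpha x h h') (ck : acts alpha x k k')
    (a : A h), fstar e' (fact ch a) = fact ck (fstar e a) }.

Definition tact (R : realType) (G H : groupoid) (alpha : iso_action G H)
    (A : fell R H) (beta : fell_action alpha A) :
  @tact_domain R G H alpha A -> tot A := tact_map (@fact R G H alpha A beta).

Section semidirect_groupoid.
Variables (G H : groupoid) (alpha : iso_action G H).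
Implicit Types (x y z : G) (h k l : H).
Local Notation rho := (rho alpha).

Definition sd_set : set (H * G) := [set hx | rho hx.1 = rng hx.2].

Definition sd_mk h x (e : rho h = rng x) : sd_set := exist _ (h, x) (mem_set e).

Implicit Types p q t : sd_set.

Lemma sdP p : rho (val p).1 = rng (val p).2.
Proof. exact: set_valP p. Qed.

Lemma sd_eq p q : (val p).1 = (val q).1 -> (val p).2 = (val q).2 -> p = q.
Proof.
move=> e1 e2; apply: val_inj.
by rewrite [val p]surjective_pairing [val q]surjective_pairing e1 e2.
Qed.

Lemma acts_fun x h k k' : acts alpha x h k -> acts alpha x h k' -> k = k'.
Proof. by move=> [e <-] [e' <-]; congr act; apply: Prop_irrelevance. Qed.

Lemma act_acts x h (e : src x = rho h) : acts alpha x h (act e).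
Proof. by exists e. Qed.

Lemma acts1 h x : x = rho h -> acts alpha x h h.
Proof.
move=> ->; have e : src (rho h) = rho h.
  by rewrite -{1}(rho_units alpha h) src_rng (rho_units alpha h).
by exists e; apply: act1.
Qed.

Lemma actsM x y z h k l : gprod x y z -> acts alpha y h k -> acts alpha x k l ->
  acts alpha z h l.
Proof.
move=> [exy <-] [ey <-] [ex <-].
have eh : src (gmul exy) = rho h by rewrite src_mul.
by exists eh; apply: actM.
Qed.

Lemma actsV x h k : acts alpha x h k -> acts alpha (ginv x) k h.
Proof.
move=> c; have [e ek] := c.
have e' : src (ginv x) = rho k by rewrite src_inv -ek rho_act.
have c' := act_acts e'.
suff <- : act e' = h by [].
apply: (acts_fun (actsM (gprod_Vl x) c c')).
exact: acts1.
Qed.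

Lemma acts_comp x h k l h' k' l' : gprod h k l -> acts alpha x h h' ->
  acts alpha x k k' -> acts alpha x l l' -> gprod h' k' l'.
Proof. by move=> c [eh <-] [ek <-] [el <-]; apply: ia_hom. Qed.

Lemma acts_rng x h k : acts alpha x h k -> acts alpha x (rng h) (rng k).
Proof.
move=> c; have [e ek] := c.
have e' : src x = rho (rng h) by rewrite rho_rng.
have c' := act_acts e'.
by have <- := gprod_idl (acts_comp (gprod_l h) c' c c).
Qed.

Lemma acts_src x h k : acts alpha x h k -> acts alpha x (src h) (src k).
Proof.
move=> c; have [e ek] := c.
have e' : src x = rho (src h) by rewrite rho_src.
have c' := act_acts e'.
by have <- := gprod_idr (acts_comp (gprod_r h) c c' c).
Qed.

Lemma rho_inv h : rho (ginv h) = rho h.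
Proof. by rewrite -rho_rng rng_inv rho_src. Qed.

Lemma rho_comp h k l : gprod h k l -> rho l = rho h.
Proof. by move=> [e <-]; rewrite -rho_rng rng_mul rho_rng. Qed.

Lemma rho_acts x h k : acts alpha x h k -> rho k = rng x.
Proof. by move=> [e <-]; apply: rho_act. Qed.

Lemma acts_inv x h k : acts alpha x h k -> acts alpha x (ginv h) (ginv k).
Proof.
move=> c; have [e ek] := c.
have e' : src x = rho (ginv h) by rewrite rho_inv.
have c' := act_acts e'.
suff <- : act e' = ginv k by [].
have cr := acts_comp (gprod_V h) c c' (acts_rng c).
have cl := gprod_Vl k.
have [e1 _] := cr.
have e2 : rng (act e') = src k by rewrite e1.
have c3 : gprod (src k) (act e') (act e') by rewrite -e2; apply: gprod_l.
have c4 := gprodA cl cr c3.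
have c5 : gprod (ginv k) (rng k) (ginv k).
  by rewrite -src_inv; apply: gprod_r.
exact: gprod_fun c4 c5.
Qed.

Lemma sd_src_proof p : src (ginv (val p).2) = rho (src (val p).1).
Proof. by rewrite src_inv rho_src sdP. Qed.

Lemma sd_inv_proof p : src (ginv (val p).2) = rho (ginv (val p).1).
Proof. by rewrite src_inv rho_inv sdP. Qed.

Definition sd_rng p : sd_set :=
  @sd_mk (rng (val p).1) (rng (val p).2)
    (etrans (rho_rng alpha _) (etrans (sdP p) (esym (rng_rng _)))).

Definition sd_src p : sd_set :=
  @sd_mk (act (sd_src_proof p)) (src (val p).2)
    (etrans (rho_act _) (etrans (rng_inv _) (esym (rng_src _)))).

Definition sd_inv p : sd_set :=
  @sd_mk (act (sd_inv_proof p)) (ginv (val p).2) (rho_act _).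

Lemma sd_act_proof p q : sd_src p = sd_rng q -> src (val p).2 = rho (val q).1.
Proof. by move=> /(congr1 val) [_ ->]; rewrite sdP. Qed.

Lemma sd_gmul1_proof p q (e : sd_src p = sd_rng q) :
  src (val p).1 = rng (act (sd_act_proof e)).
Proof.
have [e1 _] := congr1 val e.
have c := act_acts (sd_src_proof p).
rewrite e1 in c.
have c1 := actsV c.
have c2 : acts alpha (val p).2 (rng (val q).1) (src (val p).1).
  have [e3 e4] := actsV c1; have e5 : src (val p).2 = rho (rng (val q).1).
    by rewrite rho_rng; apply: sd_act_proof.
  have c6 := act_acts e5.
  have c7 := actsM (gprod_V (val p).2) c c6.
  have c8 : acts alpha (rng (val p).2) (src (val p).1) (src (val p).1).
    by apply: acts1; rewrite rho_src sdP.
  by rewrite (acts_fun c8 c7).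
exact: acts_fun c2 (acts_rng (act_acts _)).
Qed.

Lemma sd_gmul2_proof p q (e : sd_src p = sd_rng q) :
  src (val p).2 = rng (val q).2.
Proof. by have [_ ->] := congr1 val e. Qed.

Lemma sd_mul_proof p q (e : sd_src p = sd_rng q) :
  rho (gmul (sd_gmul1_proof e)) = rng (gmul (sd_gmul2_proof e)).
Proof. by rewrite rng_mul -rho_rng rng_mul rho_rng sdP. Qed.

Definition sd_mul p q (e : sd_src p = sd_rng q) : sd_set :=
  sd_mk (sd_mul_proof e).

Lemma sd_src_acts p : acts alpha (val p).2 (val (sd_src p)).1 (src (val p).1).
Proof.
have c := actsV (act_acts (sd_src_proof p)).
have e : src (val p).2 = rho (val (sd_src p)).1.
  by rewrite /= rho_act rng_inv.
have c' := act_acts e.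
have c1 := actsM (gprod_V (val p).2) (act_acts (sd_src_proof p)) c'.
have c2 : acts alpha (rng (val p).2) (src (val p).1) (src (val p).1).
  by apply: acts1; rewrite rho_src sdP.
by rewrite (acts_fun c2 c1).
Qed.

Lemma sd_srcE p k : acts alpha (val p).2 k (src (val p).1) ->
  (val (sd_src p)).1 = k.
Proof.
by move=> /actsV c; apply: acts_fun (act_acts (sd_src_proof p)) c.
Qed.

Lemma sd_srcP p q (e : sd_src p = sd_rng q) k :
  acts alpha (val p).2 (val q).1 k -> gprod (val p).1 k (val (sd_mul e)).1.
Proof.
move=> c; rewrite -(acts_fun (act_acts (sd_act_proof e)) c).
by exists (sd_gmul1_proof e).
Qed.

Lemma sd_mul2 p q (e : sd_src p = sd_rng q) :
  gprod (val p).2 (val q).2 (val (sd_mul e)).2.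
Proof. by exists (sd_gmul2_proof e). Qed.

Lemma sd_rng_mul p q (e : sd_src p = sd_rng q) : sd_rng (sd_mul e) = sd_rng p.
Proof. by apply: sd_eq => /=; rewrite rng_mul. Qed.

Lemma sd_src_mul p q (e : sd_src p = sd_rng q) : sd_src (sd_mul e) = sd_src q.
Proof.
apply: sd_eq; last by rewrite /= src_mul.
apply: sd_srcE.
have c1 := act_acts (sd_act_proof e).
have c2 := sd_src_acts q.
have -> : src (val (sd_mul e)).1 = src (act (sd_act_proof e)).
  by rewrite /= src_mul.
exact: actsM (sd_mul2 e) c2 (acts_src c1).
Qed.

Lemma sd_mulA p q t (epq : sd_src p = sd_rng q) (eqt : sd_src q = sd_rng t)
    (el : sd_src (sd_mul epq) = sd_rng t) (er : sd_src p = sd_rng (sd_mul eqt)) :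
  sd_mul el = sd_mul er.
Proof.
have c2 : gprod (val p).2 (val (sd_mul eqt)).2 (val (sd_mul el)).2.
  exact: gprodA (sd_mul2 epq) (sd_mul2 eqt) (sd_mul2 el).
apply: sd_eq; last exact: gprod_fun c2 (sd_mul2 er).
have a1 := act_acts (sd_act_proof epq).
have a2 := act_acts (sd_act_proof eqt).
have a3 := act_acts (sd_act_proof el).
have a4 := act_acts (sd_act_proof er).
have m1 := sd_srcP epq a1. have m2 := sd_srcP eqt a2.
have m3 := sd_srcP el a3. have m4 := sd_srcP er a4.
have e5 : src (val p).2 = rho (act (sd_act_proof eqt)).
  by rewrite rho_act (sd_gmul2_proof epq).
have a5 := act_acts e5.
have e6 := acts_fun (actsM (sd_mul2 epq) a2 a5) a3.
rewrite e6 in a5.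
have m5 := acts_comp m2 a1 a5 a4.
have [ee _] := m5.
have m6 := gprodA m1 m5 m3.
exact: gprod_fun m6 m4.
Qed.

Lemma sd_rng_rng p : sd_rng (sd_rng p) = sd_rng p.
Proof. by apply: sd_eq => /=; rewrite rng_rng. Qed.

Lemma sd_src_rng p : sd_src (sd_rng p) = sd_rng p.
Proof.
apply: sd_eq; last by rewrite /= src_rng.
by apply: sd_srcE; rewrite /= src_rng; apply: acts1; rewrite rho_rng sdP.
Qed.

Lemma sd_rng_src p : sd_rng (sd_src p) = sd_src p.
Proof.
apply: sd_eq; last by rewrite /= rng_src.
apply/esym/sd_srcE.
by have := acts_rng (sd_src_acts p); rewrite rng_src.
Qed.

Lemma sd_src_src p : sd_src (sd_src p) = sd_src p.
Proof. by have := sd_src_rng (sd_src p); rewrite sd_rng_src. Qed.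

Lemma sd_mul1l p (e : sd_src (sd_rng p) = sd_rng p) : sd_mul e = p.
Proof.
have c2 := sd_mul2 e.
apply: sd_eq; last exact: gprod_fun c2 (gprod_l _).
have c : acts alpha (val (sd_rng p)).2 (val p).1 (val p).1.
  by apply: acts1; rewrite sdP.
exact: gprod_fun (sd_srcP e c) (gprod_l _).
Qed.

Lemma sd_mul1r p (e : sd_src p = sd_rng (sd_src p)) : sd_mul e = p.
Proof.
have c2 := sd_mul2 e.
apply: sd_eq; last exact: gprod_fun c2 (gprod_r _).
exact: gprod_fun (sd_srcP e (sd_src_acts p)) (gprod_r _).
Qed.

Lemma sd_inv_acts p : acts alpha (val p).2 (val (sd_inv p)).1 (ginv (val p).1).
Proof.
have c := act_acts (sd_inv_proof p).
have e : src (val p).2 = rho (val (sd_inv p)).1 by rewrite /= rho_act rng_inv.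
have c1 := actsM (gprod_V (val p).2) c (act_acts e).
have c2 : acts alpha (rng (val p).2) (ginv (val p).1) (ginv (val p).1).
  by apply: acts1; rewrite rho_inv sdP.
rewrite (acts_fun c2 c1); exact: act_acts.
Qed.

Lemma sd_rng_inv p : sd_rng (sd_inv p) = sd_src p.
Proof.
apply: sd_eq; last by rewrite /= rng_inv.
apply/esym/sd_srcE; rewrite -rng_inv.
exact: acts_rng (sd_inv_acts p).
Qed.

Lemma sd_src_inv p : sd_src (sd_inv p) = sd_rng p.
Proof.
apply: sd_eq; last by rewrite /= src_inv.
apply: sd_srcE.
have := acts_src (sd_inv_acts p); rewrite src_inv => c.
exact: (actsV c).
Qed.

Lemma sd_mulV p (e : sd_src p = sd_rng (sd_inv p)) : sd_mul e = sd_rng p.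
Proof.
have c2 := sd_mul2 e.
apply: sd_eq; last exact: gprod_fun c2 (gprod_V _).
exact: gprod_fun (sd_srcP e (sd_inv_acts p)) (gprod_V _).
Qed.

Lemma sd_mulVl p (e : sd_src (sd_inv p) = sd_rng p) : sd_mul e = sd_src p.
Proof.
have c2 := sd_mul2 e.
apply: sd_eq; last exact: gprod_fun c2 (gprod_Vl _).
apply/esym/sd_srcE.
have a1 := act_acts (sd_act_proof e).
have a2 : acts alpha (val p).2 (act (sd_act_proof e)) (val p).1.
  have e3 : src (val p).2 = rho (act (sd_act_proof e)) by rewrite rho_act rng_inv.
  have c1 := actsM (gprod_V (val p).2) a1 (act_acts e3).
  have c3 : acts alpha (rng (val p).2) (val p).1 (val p).1.
    by apply: acts1; rewrite sdP.
  rewrite {2}(acts_fun c3 c1); exact: act_acts.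
have m := sd_srcP e a1.
have e4 : src (val p).2 = rho (val (sd_mul e)).1.
  by rewrite (rho_comp m) /= rho_act rng_inv.
have a4 := act_acts e4.
have m' := acts_comp m (sd_inv_acts p) a2 a4.
by rewrite -(gprod_fun m' (gprod_Vl _)).
Qed.

Definition semidirect : groupoid :=
  Groupoid sd_rng_mul sd_src_mul sd_mulA sd_rng_rng sd_src_rng sd_rng_src
    sd_src_src sd_mul1l sd_mul1r sd_rng_inv sd_src_inv sd_mulV sd_mulVl.

End semidirect_groupoid.

Section semidirect_fell.
Variables (R : realType) (G H : groupoid) (alpha : iso_action G H).
Variables (A : fell R H) (beta : fell_action alpha A).
Local Notation S := (semidirect alpha).

Definition sd_fib (p : S) : completeNormedModType R[i] := A (val p).1.

(* The total space is {(a,x) | rho (p a) = rng x}, here written as pairs of an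
   arrow (h,x) and a vector of A h; it has the relative topology of tot A * G. *)
Definition sd_emb (t : total_space sd_fib) : tot A * G :=
  (Pt (vec t : A (val (base t)).1), (val (base t)).2).

Definition sd_open : set (set (total_space sd_fib)) :=
  [set sd_emb @^-1` U | U in open].

Lemma sd_openT : sd_open setT.
Proof. by exists setT => //; apply: openT. Qed.

Lemma sd_openI : setI_closed sd_open.
Proof.
by move=> _ _ [U oU <-] [V oV <-]; exists (U `&` V) => //; apply: openI.
Qed.

Lemma sd_open_bigU (I : Type) (f : I -> set (total_space sd_fib)) :
  (forall i, sd_open (f i)) -> sd_open (\bigcup_i f i).
Proof.
move=> of_.
have /choice[g gP] : forall i, exists U, open U /\ sd_emb @^-1` U = f i.
  by move=> i; have [U oU <-] := of_ i; exists U.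
exists (\bigcup_i g i); first by apply: bigcup_open => i _; have [] := gP i.
by rewrite preimage_bigcup; apply: eq_bigcupr => i _; have [] := gP i.
Qed.

Definition sd_bundle : bundle R S := Bundle sd_openT sd_openI sd_open_bigU.

Lemma sd_comp_act (p q t : S) : gprod p q t ->
  src (val p).2 = rho alpha (val q).1.
Proof. by move=> [e _]; apply: sd_act_proof e. Qed.

Lemma sd_comp (p q t : S) (c : gprod p q t) :
  gprod (val p).1 (act (sd_comp_act c)) (val t).1.
Proof.
have [e et] := c.
have := @sd_srcP _ _ _ _ _ e _ (act_acts (sd_comp_act c)).
by rewrite (_ : sd_mul e = t).
Qed.

(* (a,x)(b,y) = (a(x.b),xy) *)
Definition sd_fmul (p q t : S) (c : gprod p q t) (a : sd_bundle p)
  (b : sd_bundle q) : sd_bundle t :=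
  fmul (sd_comp c) (a : A (val p).1)
    (fact beta (act_acts (sd_comp_act c)) (b : A (val q).1)).

Lemma sd_inv_actsV (p q : S) : ginv p = q ->
  acts alpha (ginv (val p).2) (ginv (val p).1) (val q).1.
Proof. by move=> <-; apply: act_acts. Qed.

(* (a,x)^* = (x^-1.a^*,x^-1) *)
Definition sd_fstar (p q : S) (e : ginv p = q) (a : sd_bundle p) :
  sd_bundle q :=
  fact beta (sd_inv_actsV e) (fstar erefl (a : A (val p).1)).

Definition semidirect_fell : fell R S := Fell sd_fmul sd_fstar.

Definition G_invariant (I : set (tot A)) : Prop :=
  forall xa : @tact_domain R G H alpha A, I (val xa).2 -> I (tact beta xa).

Definition invariant_ideal : set (set (tot A)) :=
  [set I | ideal I /\ G_invariant I].

Definition semidirect_ideal (I : set (tot A)) : set (tot semidirect_fell) :=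
  [set t | I (sd_emb t).1].

End semidirect_fell.

Arguments G_invariant {R G H alpha A} beta I.
Arguments invariant_ideal {R G H alpha A} beta.
Arguments semidirect_ideal {R G H alpha A} beta I.

Definition is_meet (T : Type) (P : set (set T)) (A B M : set T) : Prop :=
  [/\ P M, M `<=` A, M `<=` B &
      forall N, P N -> N `<=` A -> N `<=` B -> N `<=` M].

Definition is_join (T : Type) (P : set (set T)) (A B M : set T) : Prop :=
  [/\ P M, A `<=` M, B `<=` M &
      forall N, P N -> A `<=` N -> B `<=` N -> M `<=` N].

Definition is_lattice (T : Type) (P : set (set T)) : Prop :=
  forall A B, P A -> P B ->
    (exists M, is_meet P A B M) /\ (exists M, is_join P A B M).

Record lattice_isomorphism (T U : Type) (P : set (set T)) (Q : set (set U))
    (f : set T -> set U) : Prop := LatticeIsomorphism {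
  li_lattice_dom : is_lattice P ;
  li_lattice_cod : is_lattice Q ;
  li_bij : set_bij P Q f ;
  li_meet : forall A B M, P A -> P B ->
    is_meet P A B M -> is_meet Q (f A) (f B) (f M) ;
  li_join : forall A B M, P A -> P B ->
    is_join P A B M -> is_join Q (f A) (f B) (f M) }.

(* Main.v *)
Require Import Defs.
From mathcomp Require Import classical_sets reals.
From mathcomp Require Import all_boot all_order all_algebra.
From mathcomp Require Import all_classical topology normedtype.
From mathcomp Require Import complex ring.

(** The inverse of the map I |-> I x G takes an ideal J of the semidirect
    product to the set of vectors that it has over the units of G (slice).  What
    makes this work is that, for an ideal J, whether (a, x) belongs to J depends on a
    alone (ideal_change_arrow).  Indeed, two arrows (h, x) and (h, y) have the
    same range, so that (h, y) = (h, x) s for some arrow s.  Multiplying (a, x)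
    on the right by the vectors over s gives (a b, y) for all b in the fibre of
    A over s(h), and a is a limit of such products a b.  As J is fibrewise
    closed, (a, y) is in J.  Now the slice is an ideal of A because the units of
    G act trivially.  It is invariant because of the involution: the adjoint of
    (a, x^-1) is (x . a^*, x), and second components may be changed freely on
    both sides.

    In the other direction, that I x G is an ideal for an invariant ideal I is a
    direct check.  Once the semidirect product is known to be a Banach bundle
    (sd_banach_bundle), the only topological condition to verify is the openness
    of the projection on I x G.  The resulting bijection preserves and reflects
    inclusion, so it is an isomorphism of lattices as soon as the invariant
    ideals of A form a lattice.  Their join is the fibrewise closure of the sum.
    Their meet is the intersection, where openness of the projection needs an
    argument (ideal_meet): a vector a of I and J is replaced by a b with b in J,
    and the factors are extended to nearby fibres in I and in J separately.

    Both arguments rest on local units: a vector a of a Fell bundle is a limit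
    of products a b, where b can be taken in every ideal that contains a
    (bundle_local_unit).  Through the inner product c = a^* a this reduces to
    finding, in a C*-algebra, bounded elements b of the right ideal generated by
    a self-adjoint c with c b close to c.  This is done without functional
    calculus.  For |c| <= 1/2 the Cayley transform u of c is a unitary of the
    form 1 + w, with w a multiple of c (cayley_transform).  If 1 - b is the mean
    of the first n powers of u, then (u - 1)(1 - b) = (u^n - 1) / n tends to 0,
    hence so does c (1 - b), as c is a multiple of u - 1 (small_local_unit). *)

Set Implicit Arguments.
Unset Strict Implicit.
Unset Printing Implicit Defensive.

Import Order.TTheory GRing.Theory Num.Theory.
Import numFieldNormedType.Exports.

Local Open Scope classical_set_scope.
Local Open Scope ring_scope.
Local Open Scope complex_scope.

(** * Bilinear and conjugate-linear maps *)

Section bilinear.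
Variables (R : realType) (U V W : completeNormedModType R[i]).
Variable m : U -> V -> W.
Hypothesis bm : bilinear_map m.

Lemma bilinDl u u' v : m (u + u') v = m u v + m u' v.
Proof. by have := bm.1 1 u u' v; rewrite !scale1r. Qed.

Lemma bilinDr u v v' : m u (v + v') = m u v + m u v'.
Proof. by have := bm.2 1 u v v'; rewrite !scale1r. Qed.

Lemma bilin0l v : m 0 v = 0.
Proof. by have := bilinDl 0 0 v; rewrite addr0 -[LHS]addr0 => /addrI. Qed.

Lemma bilin0r u : m u 0 = 0.
Proof. by have := bilinDr u 0 0; rewrite addr0 -[LHS]addr0 => /addrI. Qed.

Lemma bilinZl k u v : m (k *: u) v = k *: m u v.
Proof. by have := bm.1 k u 0 v; rewrite bilin0l !addr0. Qed.

Lemma bilinZr k u v : m u (k *: v) = k *: m u v.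
Proof. by have := bm.2 k u v 0; rewrite bilin0r !addr0. Qed.

Lemma bilinNl u v : m (- u) v = - m u v.
Proof. by rewrite -scaleN1r bilinZl scaleN1r. Qed.

Lemma bilinNr u v : m u (- v) = - m u v.
Proof. by rewrite -scaleN1r bilinZr scaleN1r. Qed.

End bilinear.

Section conj_linear.
Variables (R : realType) (U V : completeNormedModType R[i]) (f : U -> V).
Hypothesis cf : conj_linear f.

Lemma conj_linD u v : f (u + v) = f u + f v.
Proof. by have := cf 1 u v; rewrite rmorph1 !scale1r. Qed.

Lemma conj_lin0 : f 0 = 0.
Proof. by have := conj_linD 0 0; rewrite addr0 -[LHS]addr0 => /addrI. Qed.

Lemma conj_linZ k u : f (k *: u) = k^* *: f u.
Proof. by have := cf k u 0; rewrite conj_lin0 !addr0. Qed.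

Lemma conj_linN u : f (- u) = - f u.
Proof. by rewrite -scaleN1r conj_linZ rmorphN rmorph1 scaleN1r. Qed.

End conj_linear.

(** * Fixed points of contractions over the complex numbers *)

(** Only nonnegative complex numbers are compared here, and these are real, so
    this is the archimedean property of R. *)
Lemma complex_archimedean (R : realType) (C e : R[i]) : 0 < e -> 0 <= C ->
  exists n : nat, C < e * n.+1%:R.
Proof.
move=> e0 C0; have /complex_realP[k ke] := gtr0_real e0.
have /complex_realP[l lC] := ger0_real C0.
move: e0 C0; rewrite ke lC ltcR lecR => k0 l0.
exists (Num.bound (l / k)); have := archi_boundP (divr_ge0 l0 (ltW k0)).
rewrite ltr_pdivrMr// => h.
rewrite -(rmorph_nat (real_complex R)) -rmorphM ltcR (lt_trans h)//.
by rewrite mulrC ltr_pM2l// ltr_nat.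
Qed.

(** The fixed point is the limit of the iterates of f at 0; the ratio one half
    keeps the geometric series explicit. *)
Lemma half_contraction_fixpoint (R : realType) (E : completeNormedModType R[i])
    (f : E -> E) :
  (forall x y, `|f x - f y| <= 2^-1 * `|x - y|) -> exists x, x = f x.
Proof.
move=> ctr; pose y n := iter n f 0; pose D := `|y 1%N - y 0%N|.
have step n : `|y n.+1 - y n| <= 2^-1 ^+ n * D.
  elim: n => [|n IH]; first by rewrite expr0 mul1r.
  by apply: le_trans (ctr _ _) _; rewrite exprS -mulrA ler_pM2l// invr_gt0.
(* The upper bound is the sum of the geometric steps between n and n + m. *)
have tail n m : `|y (n + m)%N - y n| <=
    2 * 2^-1 ^+ n * D - 2 * 2^-1 ^+ (n + m) * D.
  elim: m => [|m IH]; first by rewrite addn0 !subrr normr0.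
  have := lerD (step (n + m)%N) IH => /(le_trans (ler_normD _ _)).
  rewrite addnS subrKA => /le_trans; apply.
  rewrite exprS le_eqVlt; apply/orP; left; apply/eqP.
  by field.
have dist n m : (n <= m)%N -> `|y m - y n| <= 2 * 2^-1 ^+ n * D.
  move=> /subnKC <-; apply: le_trans (tail _ _) _.
  by rewrite gerBl !mulr_ge0 ?exprn_ge0 ?invr_ge0 ?ler0n ?normr_ge0.
have small (e : R[i]) : 0 < e -> exists N, forall n, (N <= n)%N ->
    2 * 2^-1 ^+ n * D < e.
  move=> e0; have [N hN] := complex_archimedean e0
    (mulr_ge0 (ler0n _ 2) (normr_ge0 (y 1%N - y 0%N))).
  exists N => n Nn; rewrite exprVn mulrAC ltr_pdivrMr ?exprn_gt0//.
  apply: lt_le_trans hN _; rewrite ler_pM2l// -natrX ler_nat.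
  exact: leq_ltn_trans Nn (ltn_expl _ _).
have cy : cvgn y.
  apply/cauchy_cvgP/cauchy_exP => e e0; have [N hN] := small _ e0.
  exists (y N), N => // n /= Nn; rewrite -ball_normE /= distrC.
  exact: le_lt_trans (dist _ _ Nn) (hN _ (leqnn _)).
exists (limn y); apply/eqP; rewrite -subr_eq0 -normr_eq0.
apply: contraT => ne.
have e0 : 0 < `|limn y - f (limn y)| by rewrite lt0r ne normr_ge0.
have /cvgrPdist_lt/(_ _ (divr_gt0 e0 (ltr0Sn _ 1)))[N _ hN] := cy.
have : `|limn y - f (limn y)| < `|limn y - f (limn y)|.
  rewrite [ltRHS]splitr -[X in `|X| < _](subrKA (y N.+1)).
  rewrite (le_lt_trans (ler_normD _ _))// ltrD//; first exact: hN (leqnSn _).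
  apply: le_lt_trans (ctr _ _) _; apply: le_lt_trans (hN N (leqnn _)).
  by rewrite distrC ler_piMl// invf_le1// ler1n.
by rewrite ltxx.
Qed.

(** * Local units in C*-algebras and Hilbert modules *)

Section cstar.
Variables (R : realType) (A : completeNormedModType R[i]).
Variables (mul : A -> A -> A) (star : A -> A).
Hypothesis csA : cstar_algebra mul star.
Local Notation "a ** b" := (mul a b) (at level 40, left associativity).
Let bm := cs_bilinear csA.
Let mA := cs_mulA csA.
Let sM := cs_star_mul csA.
Let sK := cs_starK csA.
Let mDl := bilinDl bm.
Let mDr := bilinDr bm.
Let mZl := bilinZl bm.
Let mZr := bilinZr bm.
Let mNl := bilinNl bm.
Let mNr := bilinNr bm.
Let sD := conj_linD (cs_conj_linear csA).
Let sZ := conj_linZ (cs_conj_linear csA).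
Let sN := conj_linN (cs_conj_linear csA).

(** From |b|^2 = |b^* b| <= |b^*| |b|, applied to both a and a^*. *)
Lemma cs_norm_star a : `|star a| = `|a|.
Proof.
have le b : `|b| <= `|star b|.
  have [->|b0] := eqVneq b 0; first by rewrite normr0 normr_ge0.
  rewrite -(ler_pM2r (_ : 0 < `|b|)) ?normr_gt0// -expr2 -(cs_norm csA).
  exact: cs_norm_mul csA _ _.
by apply/eqP; rewrite eq_le le -{2}(sK a) le.
Qed.

Let iC : R[i] := 'i%R.

Lemma small_fixpoint0 c z : `|c| <= 2^-1 -> z = iC *: (c ** z) -> z = 0.
Proof.
move=> c2 zE; apply/eqP; rewrite -normr_eq0; apply: contraT => ne.
have z0 : 0 < `|z| by rewrite lt0r ne normr_ge0.
have : `|z| <= 2^-1 * `|z|.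
  rewrite {1}zE normrZ normCi mul1r.
  by apply: le_trans (cs_norm_mul csA _ _) _; rewrite ler_pM2r.
by rewrite ler_pMl// invf_ge1// (ler_nat _ 2 1).
Qed.

(** Formally 1 + w = (1 + ic)(1 - ic)^-1, the Cayley transform of c.  The
    algebra may have no unit, so w itself is produced, as the fixed point that
    the Neumann series of (1 - ic)^-1 computes; the last equation says that
    (1 + w)^* (1 + w) = 1.  Both it and the commutation hold because the
    defect z satisfies z = ic z, which forces z = 0 when |c| <= 1/2. *)
Lemma cayley_transform c : star c = c -> `|c| <= 2^-1 -> exists w,
  [/\ w = (2 * iC) *: c + iC *: (c ** w), c ** w = w ** c &
      star w ** w + w + star w = 0].
Proof.
move=> sc c2.
have [x y|w wE] := @half_contraction_fixpoint _ _
    (fun x => (2 * iC) *: c + iC *: (c ** x)).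
  rewrite opprD addrACA subrr add0r -scalerBr -mNr -mDr normrZ.
  rewrite normCi mul1r.
  apply: le_trans (cs_norm_mul csA _ _) _; exact: ler_wpM2r.
have icw : iC *: (c ** w) = w - (2 * iC) *: c.
  by rewrite {2}wE addrC addKr.
have cw : c ** w = w ** c.
  apply/subr0_eq/(small_fixpoint0 c2).
  rewrite mDr mNr (mA c w c) scalerBr -mZr icw -mZl icw mDr mDl mNr mNl mZr mZl.
  by rewrite opprB addrA subrK.
have scw : c ** star w = star w ** c by rewrite -{1}sc -sM -cw sM sc.
have swE : star w = - ((2 * iC) *: c) - iC *: (star w ** c).
  by rewrite {1}wE sD !sZ sM sc rmorphM /= conjC_nat conjCi mulrN !scaleNr.
exists w; split=> //.
apply: (small_fixpoint0 c2).
rewrite !mDr mA scw -mA !scalerDr -mZr icw mDr mNr mZr.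
rewrite [X in _ + X = _]swE.
have -> : (2 * iC) *: (star w ** c) = iC *: (star w ** c) + iC *: (star w ** c).
  by rewrite mulr_natl mulr2n scalerDl.
rewrite [X in _ = X + _]addrACA opprD -!addrA; do 2!congr (_ + _).
by rewrite [- (_ *: c) + iC *: _]addrC addKr addrC.
Qed.

(** u^n - 1, for u = 1 + w in the unitization. *)
Definition unitary_power w n : A := iter n (fun v => w + v + w ** v) 0.

(** The equation says that (1 + v)^* (1 + v) = 1 for v = u^n - 1.  For the
    induction step, u^(n+1) - 1 = w + u v, and left multiplication by u
    preserves the inner product x^* y. *)
Lemma unitary_powerP w n : star w ** w + w + star w = 0 ->
  star (unitary_power w n) ** unitary_power w n =
  - (unitary_power w n + star (unitary_power w n)).
Proof.
move=> uw; have sww : star w ** w = - (w + star w).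
  by apply/eqP; rewrite -subr_eq0 opprK addrA uw.
elim: n => [|n].
  by rewrite /= (bilin0r bm) add0r (conj_lin0 (cs_conj_linear csA)) oppr0.
rewrite [unitary_power w n.+1]/=; move: (unitary_power w n) => v.
have cross x : star w ** (x + w ** x) = - (w ** x).
  by rewrite mDr mA sww mNl mDl opprD addrCA subrr addr0.
(* u^* u = 1 *)
have iso : star (v + w ** v) ** (v + w ** v) = star v ** v.
  by rewrite sD sM mDl -mA cross mDr mNr addrK.
have cross' : star (v + w ** v) ** w = - (star v ** star w).
  by rewrite -[LHS]sK sM sK cross sN sM.
rewrite -addrA sD mDr !mDl sww iso cross cross' => ->.
rewrite [star (_ + w ** v)]sD sM.
rewrite -!opprD; congr (- _).
by rewrite [LHS](AC (2*1*(1*2)) ((1*(5*4))*(2*(6*3)))).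
Qed.

(** For v = u^n - 1, unitarity turns the C*-identity into |v|^2 = |v + v^*|,
    which is at most 2 |v|. *)
Lemma norm_unitary_power w n : star w ** w + w + star w = 0 ->
  `|unitary_power w n| <= 2.
Proof.
move=> /(@unitary_powerP w n); move: (unitary_power w n) => v vv.
have [->|v0] := eqVneq v 0; first by rewrite normr0.
rewrite -(ler_pM2r (_ : 0 < `|v|)) ?normr_gt0// -expr2 -(cs_norm csA) vv.
rewrite normrN mulr_natl mulr2n -[in X in _ <= _ + X]cs_norm_star.
exact: ler_normD.
Qed.

(** A mean ergodic argument.  With u the Cayley transform of c, put
    1 - b = (1 + u + ... + u^(n-1)) / n.  Then (u - 1)(1 - b) = (u^n - 1) / n
    has norm at most 2 / n, and c is a multiple of u - 1, since
    2ic = (1 - ic)(u - 1); hence c - c b tends to 0.  The shape of b puts it in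
    every right ideal that contains c. *)
Lemma small_local_unit c e : star c = c -> `|c| <= 2^-1 -> 0 < e ->
  exists b k d, [/\ b = k *: c + c ** d, `|b| <= 2 & `|c - c ** b| < e].
Proof.
move=> sc c2 e0; have [w [wE cw uw]] := cayley_transform sc c2.
pose S n := \sum_(k < n) unitary_power w k.
have SS n : S n.+1 = S n + unitary_power w n by rewrite /S big_ord_recr.
(* (u - 1)(1 + u + ... + u^(n-1)) = u^n - 1 *)
have mean n : n%:R *: w + w ** S n = unitary_power w n.
  elim: n => [|n IH]; first by rewrite /S big_ord0 (bilin0r bm) addr0 scale0r.
  by rewrite SS mDr -natr1 scalerDl scale1r addrACA IH addrCA addrA.
have Sin n : exists k d, S n = k *: c + c ** d.
  have vin m : exists k d, unitary_power w m = k *: c + c ** d.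
    elim: m => [|m [k [d E]]].
      by exists 0, 0; rewrite scale0r (bilin0r bm) addr0.
    exists (2 * iC + k), (iC *: w + d + ((2 * iC) *: unitary_power w m +
      iC *: (w ** unitary_power w m))).
    rewrite [LHS]/= -/(unitary_power w m).
    have wv : w ** unitary_power w m = c ** ((2 * iC) *: unitary_power w m +
        iC *: (w ** unitary_power w m)).
      by rewrite {1}wE mDl !mZl mDr !mZr mA.
    rewrite [in LHS]wv; move: (_ + _ *: (w ** _)) => T.
    rewrite E {1}wE !mDr scalerDl mZr !addrA; congr (_ + _ + _).
    by rewrite addrAC.
  elim: n => [|n [k [d E]]].
    by exists 0, 0; rewrite /S big_ord0 scale0r (bilin0r bm) addr0.
  have [k' [d' E']] := vin n; exists (k + k'), (d + d').
  by rewrite SS E E' addrACA -scalerDl -mDr.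
have [n nE] := complex_archimedean e0 (ler0n _ 2).
have n0 : 0 < n.+1%:R :> R[i] by rewrite ltr0n.
have [k [d E]] := Sin n.+1.
exists (- n.+1%:R^-1 *: S n.+1), (- n.+1%:R^-1 * k), (- n.+1%:R^-1 *: d); split.
- by rewrite E scalerDr scalerA mZr.
- rewrite normrZ normrN normfV ger0_norm ?ler0n// ler_pdivrMl//.
  rewrite (le_trans (ler_norm_sum _ _ _))//.
  rewrite (@le_trans _ _ (\sum_(k < n.+1) 2))//.
    by apply: ler_sum => i _; exact: norm_unitary_power.
  by rewrite sumr_const card_ord mulr_natl.
(* 2ic (1 + u + ... + u^(n-1)) = (1 - ic)(u^n - 1) *)
have key : (2 * iC) *: (n.+1%:R *: c + c ** S n.+1) =
    unitary_power w n.+1 - iC *: (c ** unitary_power w n.+1).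
  have icw : (2 * iC) *: c = w - iC *: (c ** w) by rewrite {1}wE addrK.
  rewrite -mean scalerDr -mZl scalerA mulrC -scalerA icw mDl mNl mZl.
  rewrite scalerBr addrACA mDr mZr scalerDr opprD mA; congr (_ + (_ + _)).
  by rewrite !scalerA mulrC.
have -> : c - c ** (- n.+1%:R^-1 *: S n.+1) =
    n.+1%:R^-1 *: ((2 * iC)^-1 *: ((2 * iC) *: (n.+1%:R *: c + c ** S n.+1))).
  rewrite scalerK; last by rewrite mulf_neq0 ?neq0Ci ?pnatr_eq0.
  by rewrite scalerDr scalerK ?gt_eqF// mZr scaleNr opprK.
rewrite key !normrZ !normfV normrM normCi mulr1 !ger0_norm ?ler0n//.
rewrite ltr_pdivrMl// [_ * e]mulrC; apply: le_lt_trans nE.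
have vn := norm_unitary_power n.+1 uw.
rewrite ler_pdivrMl//; apply: le_trans (ler_normB _ _) _.
rewrite [leRHS]mulr_natl [leRHS]mulr2n lerD// normrZ normCi mul1r.
apply: le_trans (cs_norm_mul csA _ _) _.
apply: le_trans (ler_pM _ _ c2 vn) _ => //.
by rewrite mulVf ?pnatr_eq0// (ler_nat _ 1 2).
Qed.

(** The condition on c - c b is homogeneous in c, so c may be scaled down. *)
Lemma local_unit c e : star c = c -> 0 < e ->
  exists b k d, [/\ b = k *: c + c ** d, `|b| <= 2 & `|c - c ** b| < e].
Proof.
move=> sc e0; pose t := (2 * (`|c| + 1))^-1.
have c1 : 0 < `|c| + 1 by rewrite ltr_wpDl.
have t0 : 0 < t by rewrite invr_gt0 mulr_gt0.
have st : star (t *: c) = t *: c by rewrite sZ sc (CrealP (gtr0_real t0)).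
have [|b [k [d [bE b2 bc]]]] := small_local_unit st _ (mulr_gt0 t0 e0).
  rewrite normrZ gtr0_norm// /t invfM -mulrA ger_pMr ?invr_gt0//.
  by rewrite mulrC ler_pdivrMr// mul1r lerDl.
exists b, (k * t), (t *: d); split=> //; first by rewrite bE scalerA mZl mZr.
by move: bc; rewrite mZl -scalerBr normrZ gtr0_norm// ltr_pM2l.
Qed.

End cstar.

(** With b a local unit for c = <a, a> and y = a - a b, the vector <y, a> is the
    adjoint of c - c b, and <y, y> = <y, a> - <y, a> b has norm at most
    3 |c - c b|, as |b| <= 2. *)
Lemma hilbert_local_unit (R : realType) (A X : completeNormedModType R[i])
    (mul : A -> A -> A) (star : A -> A) (act : X -> A -> X) (ip : X -> X -> A)
    (a : X) (e : R[i]) :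
  cstar_algebra mul star -> right_hilbert_module mul star act ip -> 0 < e ->
  exists b k d, b = k *: ip a a + mul (ip a a) d /\ `|a - act a b| < e.
Proof.
move=> csA rh e0; have bm := cs_bilinear csA.
have [|b [k [d [bE b2 bc]]]] :=
  local_unit csA (rh_ip_star rh a a) (_ : 0 < e ^+ 2 / 3).
  by rewrite divr_gt0// exprn_gt0.
exists b, k, d; split=> //; set y := a - act a b.
have ipB z u v : ip z (u - v) = ip z u - ip z v.
  by rewrite addrC -scaleN1r (rh_ip_linear rh) scaleN1r addrC.
have yy : ip y y = ip y a - mul (ip y a) b by rewrite {2}/y ipB (rh_ip_act rh).
have ya : `|ip y a| < e ^+ 2 / 3.
  by rewrite -(rh_ip_star rh) (cs_norm_star csA) /y ipB (rh_ip_act rh).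
rewrite -(@ltr_pXn2r _ 2) ?nnegrE// ?ltW//.
rewrite (rh_norm rh) yy (le_lt_trans (ler_normB _ _))//.
apply: (@le_lt_trans _ _ (`|ip y a| * 3)); last by rewrite -ltr_pdivlMr.
rewrite -[3]/((1 + 2)%:R) natrD mulrDr mulr1 lerD2l.
apply: le_trans (cs_norm_mul csA _ _) _; exact: ler_wpM2l.
Qed.

(** * Neighbourhoods in Banach bundles *)

Lemma open_setX (X Y : topologicalType) (V : set X) (W : set Y) :
  open V -> open W -> open (V `*` W).
Proof.
move=> oV oW; rewrite openE => -[x y] [Vx Wy]; exists (V, W) => //=.
by split; apply: open_nbhs_nbhs.
Qed.

Lemma continuous_openP (X Y : topologicalType) (f : X -> Y) :
  continuous f <-> forall x U, open U -> U (f x) ->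
    exists V, [/\ open V, V x & forall x', V x' -> U (f x')].
Proof.
split=> [cf x U oU Ufx|h x U].
  exists (f @^-1` U); split=> //; exact: (continuousP f).1 cf U oU.
rewrite nbhsE => -[W [oW Wx] WU].
have [V [oV Vx VW]] := h x W oW Wx.
rewrite nbhs_simpl /= nbhsE; exists V => // x' /VW /WU.
by [].
Qed.

(** Addition and multiplication of a bundle are maps on subspaces of a product;
    this form of continuity avoids subtypes in what follows. *)
Lemma continuous_prodset_openP (X Y Z : topologicalType) (D : set (X * Y))
    (f : D -> Z) :
  continuous f <-> forall p U, open U -> U (f p) -> exists V W,
    [/\ open V, open W, V (val p).1, W (val p).2 &
        forall q, V (val q).1 -> W (val q).2 -> U (f q)].
Proof.
rewrite continuous_openP; split=> h p U oU Up.
  have [_ [[P oP <-] Pp PU]] := h p U oU Up.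
  have : nbhs (val p) P by apply: open_nbhs_nbhs.
  move=> [[V' W']] /= [nV nW] VWP.
  move: nV nW; rewrite !nbhsE => -[V [oV Vp] VV'] [W [oW Wp] WW'].
  exists V, W; split=> // q Vq Wq; apply: PU; apply: VWP => /=.
  by split; [apply: VV'|apply: WW'].
have [V [W [oV oW Vp Wp VWU]]] := h p U oU Up.
exists [set q : D | V (val q).1 /\ W (val q).2]; split=> //.
  exists (V `*` W) => //; exact: open_setX.
by move=> q [Vq Wq]; apply: VWU.
Qed.

Section banach_bundle.
Variables (R : realType) (X : topologicalType) (B : bundle R X).

(** Continuity and semicontinuity restrict to subsets, so the only topological
    condition on a family of closed subspaces is that the projection stays
    open on it. *)
Lemma banach_bundle_sub (I : set (tot B)) :
  banach_bundle_on [set: tot B] ->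
  (forall x, I (Pt (0 : B x))) ->
  (forall x k (a b : B x), I (Pt a) -> I (Pt b) -> I (Pt (k *: a + b))) ->
  (forall x, closed [set a : B x | I (Pt a)]) ->
  (forall U : set (tot B), open U -> open [set base b | b in U `&` I]) ->
  banach_bundle_on I.
Proof.
move=> bbT I0 Ilin Icl Iop; split=> //.
- exact: continuous_subspaceW (@subsetT _ _) (bb_proj_continuous bbT).
- by move=> x; exists (Pt (0 : B x)).
- move=> e; apply: open_subspaceW.
  have /open_subspaceP[V oV] := @bb_norm_usc _ _ _ _ bbT e.
  by rewrite !setIT => <-.
- exact: continuous_subspaceW (bb_add_continuous bbT).
- move=> k; apply: continuous_subspaceW (@subsetT _ _) _.
  exact: (@bb_scale_continuous _ _ _ _ bbT k).
- by move=> F x PF FI; apply: (@bb_norm0 _ _ _ _ bbT F x) => //; exact: filterT.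
Qed.

Hypothesis bbT : banach_bundle_on [set: tot B].

Lemma proj_continuous : continuous (@base X (fib B) : tot B -> X).
Proof. exact/continuous_subspace_setT/(bb_proj_continuous bbT). Qed.

Lemma scale_continuous k :
  continuous (fun b : tot B => Pt (k *: vec b) : tot B).
Proof. exact/continuous_subspace_setT/(@bb_scale_continuous _ _ _ _ bbT k). Qed.

Lemma tadd_continuous : continuous (@tadd R X B).
Proof.
apply/continuous_subspace_setT; have := bb_add_continuous bbT.
by rewrite (_ : [set _ | _] = setT)//; apply/seteqP; split.
Qed.

Lemma norm_usc e : open [set b : tot B | tnorm b < e].
Proof.
have /open_subspaceP[V oV] := @bb_norm_usc _ _ _ _ bbT e.
by rewrite !setIT => <-.
Qed.

Lemma fibre_addE x (a b : B x) (e : x = x) :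
  @fibre_add R X B (Pt a) (Pt b) e = Pt (a + b).
Proof. by rewrite (Prop_irrelevance e erefl). Qed.

Lemma taddE x (a b : B x) (q : @same_fibre R X B) :
  val q = (Pt a, Pt b) -> tadd q = Pt (a + b).
Proof. by case: q => q m /= qE; subst q; exact: fibre_addE. Qed.

Lemma add_nbhs x (a b : B x) (U : set (tot B)) : open U -> U (Pt (a + b)) ->
  exists V W, [/\ open V, open W, V (Pt a), W (Pt b) &
    forall y (a' b' : B y), V (Pt a') -> W (Pt b') -> U (Pt (a' + b'))].
Proof.
move=> oU Uab.
have s y (c d : B y) : (Pt c, Pt d) \in @same_fibre R X B by apply/mem_set.
pose q y (c d : B y) : @same_fibre R X B := exist _ (Pt c, Pt d) (s y c d).
have addE y (c d : B y) : tadd (q y c d) = Pt (c + d) by exact: taddE.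
have [|V [W [oV oW Va Wb VW]]] :=
  (continuous_prodset_openP _).1 tadd_continuous (q x a b) U oU.
  by rewrite addE.
exists V, W; split=> // y a' b' Va' Wb'.
by rewrite -addE; apply: VW.
Qed.

(** The inclusion of a fibre in the total space is continuous: small vectors
    tend to the zero section, and c = a + (c - a). *)
Lemma Pt_near x (a : B x) (U : set (tot B)) : open U -> U (Pt a) ->
  exists2 e : R[i], 0 < e & forall c : B x, `|a - c| < e -> U (Pt c).
Proof.
move=> oU Ua.
have [|V [W [oV oW Va Wb VW]]] := add_nbhs (a := a) (b := 0) oU.
  by rewrite addr0.
have : (fun b : B x => Pt b : tot B) @ nbhs (0 : B x) -->
    (Pt (0 : B x) : tot B).
  apply: (@bb_norm0 _ _ _ _ bbT) => //.
  - exact: filterT.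
  - exact: cvg_cst.
  - move=> e e0; exact: nbhs0_lt.
move=> /(_ W (open_nbhs_nbhs (conj oW Wb))) /nbhs_ballP[e /= e0 eW].
exists e => // c ac; rewrite -(subrKC a c); apply: VW => //; apply: eW.
by rewrite -ball_normE /= sub0r opprB.
Qed.

End banach_bundle.

(** * Ideals of Fell bundles and their lattice operations *)

Lemma ginvK (G : groupoid) (x : G) : ginv (ginv x) = x.
Proof.
have c : gprod (ginv (ginv x)) (ginv x) (rng x).
  by have := gprod_Vl (ginv x); rewrite src_inv.
have c' := gprodA c (gprod_Vl x) (gprod_l x).
have c'' : gprod (ginv (ginv x)) (src x) (ginv (ginv x)).
  by have := gprod_r (ginv (ginv x)); rewrite src_inv rng_inv.
exact: gprod_fun c'' c'.
Qed.

Section ideals.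
Variables (R : realType) (G : groupoid) (B : fell R G).
Implicit Types I : set (tot B).

Lemma tmulE (bc : @tcomposable R G B) z
    (c : gprod (base (val bc).1) (base (val bc).2) z) :
  tmul bc = Pt (fmul c (vec (val bc).1) (vec (val bc).2)).
Proof.
case: c => e ez; subst z.
by rewrite /tmul /fibre_mul (Prop_irrelevance (set_valP bc) e).
Qed.

Lemma ideal_intro I : banach_bundle_on [set: tot B] ->
  (forall x, I (Pt (0 : B x))) ->
  (forall x k (a b : B x), I (Pt a) -> I (Pt b) -> I (Pt (k *: a + b))) ->
  (forall x, closed [set a : B x | I (Pt a)]) ->
  (forall U : set (tot B), open U -> open [set base b | b in U `&` I]) ->
  (forall x y z (c : gprod x y z) (a : B x) (b : B y), I (Pt a) \/ I (Pt b) ->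
     I (Pt (fmul c a b))) ->
  (forall x (a : B x), I (Pt a) -> I (Pt (fstar erefl a))) ->
  ideal I.
Proof.
move=> bbT I0 Ilin Icl Iop Imul Istar.
have absorb (bc : @tcomposable R G B) :
    I (val bc).1 \/ I (val bc).2 -> I (tmul bc).
  by case: bc => -[[x a] [y b]] /= m Iab; apply: Imul.
split=> //; split; first exact: banach_bundle_sub.
  by move=> bc Ib _; apply: absorb; left.
by move=> [x a] Ia; apply: Istar.
Qed.

Section one_ideal.
Variable I : set (tot B).
Hypothesis idI : ideal I.
Let bbI := fs_banach (id_subbundle idI).

Lemma ideal0 x : I (Pt (0 : B x)).
Proof. exact: (@bb_zero _ _ _ _ bbI x). Qed.

Lemma ideal_linear x k (a b : B x) :
  I (Pt a) -> I (Pt b) -> I (Pt (k *: a + b)).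
Proof. exact: (@bb_linear _ _ _ _ bbI). Qed.

(** The fibres of an ideal are closed. *)
Lemma ideal_approx x (a : B x) :
  (forall e : R[i], 0 < e -> exists2 b : B x, I (Pt b) & `|a - b| < e) ->
  I (Pt a).
Proof.
move=> h; have -> : I (Pt a) = [set a : B x | I (Pt a)] a by [].
have /closure_id -> := @bb_closed _ _ _ _ bbI x.
move=> U /nbhs_ballP[e /= e0 eU]; have [b Ib ab] := h e e0.
by exists b; split=> //; apply: eU; rewrite -ball_normE.
Qed.

Lemma ideal_proj_open (U : set (tot B)) : open U ->
  open [set base b | b in U `&` I].
Proof. exact: (@bb_proj_open _ _ _ _ bbI U). Qed.

Lemma ideal_mul x y z (c : gprod x y z) (a : B x) (b : B y) :
  I (Pt a) \/ I (Pt b) -> I (Pt (fmul c a b)).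
Proof.
move=> Iab.
have m : (Pt a, Pt b) \in @tcomposable R G B by apply/mem_set; case: c.
pose q : @tcomposable R G B := exist _ (Pt a, Pt b) m.
by rewrite -(@tmulE q z c); apply: (id_absorb idI).
Qed.

Lemma ideal_star x y (e : ginv x = y) (a : B x) :
  I (Pt a) -> I (Pt (fstar e a)).
Proof. by subst y => /(fs_star (id_subbundle idI)). Qed.

End one_ideal.

Hypothesis fbB : fell_bundle B.
Let bbT := fb_banach fbB.

(** From |b|^2 = |b b^*| <= |b| |b^*|, applied to both a and a^*. *)
Lemma fstar_norm x y (e : ginv x = y) (a : B x) : `|fstar e a| = `|a|.
Proof.
have le z z' (e' : ginv z = z') (b : B z) : `|b| <= `|fstar e' b|.
  have [->|b0] := eqVneq b 0; first by rewrite normr0 normr_ge0.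
  subst z'; rewrite -(ler_pM2l (_ : 0 < `|b|)) ?normr_gt0// -expr2.
  rewrite (lh_norm (ib_left (fb_imprimitivity fbB z))).
  exact: (fb_norm_mul fbB).
have e' : ginv y = x by rewrite -e ginvK.
by apply/eqP; rewrite eq_le le -{2}(fb_starK fbB e e' a) le.
Qed.

Lemma mul_nbhs x y z (c : gprod x y z) (a : B x) (b : B y) (U : set (tot B)) :
  open U -> U (Pt (fmul c a b)) -> exists V W,
    [/\ open V, open W, V (Pt a), W (Pt b) &
    forall x' y' z' (c' : gprod x' y' z') (a' : B x') (b' : B y'),
      V (Pt a') -> W (Pt b') -> U (Pt (fmul c' a' b'))].
Proof.
move=> oU Uab.
have s x' y' z' (c' : gprod x' y' z') (a' : B x') (b' : B y') :
  (Pt a', Pt b') \in @tcomposable R G B by apply/mem_set; case: c'.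
pose q x' y' z' (c' : gprod x' y' z') (a' : B x') (b' : B y') :
  @tcomposable R G B := exist _ (Pt a', Pt b') (s _ _ _ c' a' b').
have qE x' y' z' c' a' b' : tmul (@q x' y' z' c' a' b') = Pt (fmul c' a' b').
  exact: (@tmulE (@q x' y' z' c' a' b')).
have [|V [W [oV oW Va Wb VW]]] := (continuous_prodset_openP _).1
  (fb_mul_continuous fbB) (q _ _ _ c a b) U oU; first by rewrite qE.
by exists V, W; split=> // x' y' z' c' a' b' Va' Wb'; rewrite -qE; apply: VW.
Qed.

(** The fibre over x is a Hilbert module over the fibre over u = s(x), with
    <a, a> = a^* a.  The local unit b is built from a^* a by right
    multiplications, so that it lies in every ideal that contains a. *)
Lemma bundle_local_unit x u (c : gprod x u x) (a : B x) (e : R[i]) : 0 < e ->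
  exists2 b : B u, forall I, ideal I -> I (Pt a) -> I (Pt b) &
    `|a - fmul c a b| < e.
Proof.
move=> e0; have ux := gprod_idr c; subst u.
have [b [k [d [bE ab]]]] := hilbert_local_unit a
  (fb_cstar fbB (units_src x)) (ib_right (fb_imprimitivity fbB x)) e0.
exists b; last by rewrite (Prop_irrelevance c (gprod_r x)).
move=> I idI Ia; rewrite bE; apply: (ideal_linear idI).
  by apply: (ideal_mul idI); right.
apply: (ideal_mul idI); left.
by apply: (ideal_mul idI); right.
Qed.

(** The point is that the projection is open on the intersection.  Near a vector
    a of both ideals there is a product a b with b in J, by local units.  If y
    is close to the base point of a, then a extends to some i in I over y and
    b to some j in J over s(y); the product i j lies in both ideals, over y, and is
    close to a b. *)
Lemma ideal_meet I J : continuous (@src G) -> ideal I -> ideal J ->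
  ideal (I `&` J).
Proof.
move=> csrc idI idJ; apply: ideal_intro => //.
- by move=> x; split; apply: ideal0.
- by move=> x k a b [Ia Ja] [Ib Jb]; split; apply: ideal_linear.
- move=> x; apply: closedI.
    exact: (@bb_closed _ _ _ _ (fs_banach (id_subbundle idI)) x).
  exact: (@bb_closed _ _ _ _ (fs_banach (id_subbundle idJ)) x).
- move=> U oU; rewrite openE => _ [[x a] [Ua [Ia Ja]] <-] /=.
  have [e e0 eU] := Pt_near bbT oU Ua.
  have [b /(_ J idJ Ja) Jb ab] := bundle_local_unit (gprod_r x) a e0.
  have [V [W [oV oW Va Wb VW]]] := mul_nbhs oU (eU _ ab).
  apply: (@filterS _ _ _ ([set base v | v in V `&` I] `&`
                  @src G @^-1` [set base w | w in W `&` J])).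
    move=> y [[[z i] [Vi Ii] /= zy] [[s j] [Wj Jj] /= sy]]; subst z s.
    exists (Pt (fmul (gprod_r y) i j)) => //; split; first exact: VW.
    by split; [apply: (ideal_mul idI); left | apply: (ideal_mul idJ); right].
  apply: open_nbhs_nbhs; split; last by split; [exists (Pt a)|exists (Pt b)].
  apply: openI; first exact: ideal_proj_open.
  by have /continuousP := csrc; apply; exact: ideal_proj_open.
- by move=> x y z c a b [[Ia Ja]|[Ib Jb]]; split; apply: ideal_mul => //;
    (left + right).
- by move=> x a [Ia Ja]; split; apply: ideal_star.
Qed.

(** The fibrewise norm closure of I + J. *)
Definition closed_sum I J : set (tot B) :=
  [set t | forall e : R[i], 0 < e -> exists i j : B (base t),
     [/\ I (Pt i), J (Pt j) & `|vec t - (i + j)| < e]].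

Lemma closed_sum_transport I J x y (f : B x -> B y) :
  (forall a b, f (a + b) = f a + f b) ->
  (exists2 M : R[i], 0 <= M & forall a, `|f a| <= M * `|a|) ->
  (forall i, I (Pt i) -> I (Pt (f i))) ->
  (forall j, J (Pt j) -> J (Pt (f j))) ->
  forall a : B x, closed_sum I J (Pt a) -> closed_sum I J (Pt (f a)).
Proof.
move=> fD [M M0 fM] fI fJ a h e e0.
have fB b d : f (b - d) = f b - f d.
  by apply/eqP; rewrite eq_sym subr_eq -fD subrK.
have [|i [j [Ii Jj aij]]] := h (e / (M + 1)).
  by rewrite divr_gt0// ltr_wpDl.
exists (f i), (f j); split; [exact: fI|exact: fJ|].
rewrite /= -fD -fB (le_lt_trans (fM _))//.
move: aij; rewrite ltr_pdivlMr ?ltr_wpDl// mulrC; apply: le_lt_trans.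
by rewrite ler_wpM2r// lerDl.
Qed.

(** The projection is open on the sum because a vector of it is close to some
    i + j, whose two terms extend separately to nearby fibres. *)
Lemma ideal_closed_sum I J : ideal I -> ideal J -> ideal (closed_sum I J).
Proof.
move=> idI idJ; apply: ideal_intro => //.
- move=> x e e0; exists 0, 0; split; [exact: ideal0|exact: ideal0|].
  by rewrite addr0 subrr normr0.
- move=> x k a b ha hb e e0.
  have k1 : 0 < 2 * (`|k| + 1) by rewrite mulr_gt0// ltr_wpDl.
  have [i [j [Ii Jj aij]]] := ha _ (divr_gt0 e0 k1).
  have [i' [j' [Ii' Jj' bij]]] := hb _ (divr_gt0 e0 (ltr0Sn _ 1)).
  exists (k *: i + i'), (k *: j + j').
  split; [exact: ideal_linear|exact: ideal_linear|].
  rewrite /= addrACA -scalerDr opprD addrACA -scalerBr.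
  rewrite (le_lt_trans (ler_normD _ _))// [e]splitr ltrD// normrZ.
  have [->|k0] := eqVneq k 0; first by rewrite normr0 mul0r divr_gt0.
  move: aij; rewrite ltr_pdivlMr// ltr_pdivlMr//; apply: le_lt_trans.
  by rewrite [leRHS]mulrC mulrAC ler_wpM2r// mulrC ler_wpM2l// lerDl.
- move=> x a cla e e0; have e2 := divr_gt0 e0 (ltr0Sn R[i] 1).
  have [b /= [hb]] := cla _ (nbhsx_ballx a _ e2).
  rewrite -ball_normE /= => ab; have [i [j [Ii Jj bij]]] := hb _ e2.
  exists i, j; split=> //=; rewrite -(subrKA b) [e]splitr.
  by rewrite (le_lt_trans (ler_normD _ _))// ltrD.
- move=> U oU; rewrite openE => _ [[x a] [Ua ha] <-] /=.
  have [e e0 eU] := Pt_near bbT oU Ua.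
  have [i [j [Ii Jj /eU Uij]]] := ha e e0.
  have [V [W [oV oW Vi Wj VW]]] := add_nbhs bbT oU Uij.
  apply: (@filterS _ _ _ ([set base v | v in V `&` I] `&`
                          [set base w | w in W `&` J])).
    move=> y [[[z i'] [Vi' Ii'] /= zy] [[s j'] [Wj' Jj'] /= sy]]; subst z s.
    exists (Pt (i' + j')) => //; split; first exact: VW.
    by move=> d d0; exists i', j'; split=> //=; rewrite subrr normr0.
  apply: open_nbhs_nbhs; split; last by split; [exists (Pt i)|exists (Pt j)].
  by apply: openI; exact: ideal_proj_open.
- move=> x y z c a b [ha|hb].
    apply: (closed_sum_transport (f := fun a => fmul c a b)) ha.
    + by move=> u v; rewrite (bilinDl (fb_mul_bilinear fbB c)).
    + by exists `|b| => // u; rewrite mulrC; exact: (fb_norm_mul fbB c u b).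
    + by move=> i Ii; apply: (ideal_mul idI); left.
    + by move=> j Jj; apply: (ideal_mul idJ); left.
  apply: (closed_sum_transport (f := fun b => fmul c a b)) hb.
  + by move=> u v; rewrite (bilinDr (fb_mul_bilinear fbB c)).
  + by exists `|a| => // u; exact: (fb_norm_mul fbB c a u).
  + by move=> i Ii; apply: (ideal_mul idI); right.
  + by move=> j Jj; apply: (ideal_mul idJ); right.
- move=> x a; apply: closed_sum_transport.
  + move=> u v.
    by rewrite (conj_linD (fb_star_conj_linear fbB (erefl (ginv x)))).
  + by exists 1 => // u; rewrite fstar_norm mul1r.
  + by move=> i; apply: ideal_star.
  + by move=> j; apply: ideal_star.
Qed.

Lemma closed_sum_subl I J : ideal J -> I `<=` closed_sum I J.
Proof.
move=> idJ [x a] Ia e e0; exists a, 0; split=> //; first exact: ideal0.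
by rewrite addr0 subrr normr0.
Qed.

Lemma closed_sum_subr I J : ideal I -> J `<=` closed_sum I J.
Proof.
move=> idI [x a] Ja e e0; exists 0, a; split=> //; first exact: ideal0.
by rewrite add0r subrr normr0.
Qed.

Lemma closed_sum_min I J K : ideal K -> I `<=` K -> J `<=` K ->
  closed_sum I J `<=` K.
Proof.
move=> idK IK JK [x a] ha; apply: (ideal_approx idK) => e e0.
have [i [j [/IK Ki /JK Kj aij]]] := ha e e0.
by exists (i + j) => //; rewrite -(scale1r i); apply: ideal_linear.
Qed.

End ideals.

(** * The topology of the semidirect-product bundle *)

Section semidirect_topology.
Variables (R : realType) (G H : groupoid) (alpha : iso_action G H).
Variables (A : fell R H) (beta : fell_action alpha A).
Hypothesis bbA : banach_bundle_on [set: tot A].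
Local Notation S := (semidirect alpha).
Local Notation E := (semidirect_fell beta).

(** The fibre of the semidirect product over p is the fibre of A over the first
    component of p only up to conversion; sdPt fixes the first of the two
    readings. *)
Definition sdPt (p : S) (a : A (val p).1) : tot E := @Pt R S E p a.

Lemma sd_box_open (V : set (tot A)) (W : set G) : open V -> open W ->
  open [set t : tot E | V (sd_emb t).1 /\ W (sd_emb t).2].
Proof. by move=> oV oW; exists (V `*` W) => //; exact: open_setX. Qed.

Lemma sd_base_box_open (V : set H) (W : set G) : open V -> open W ->
  open [set p : S | V (val p).1 /\ W (val p).2].
Proof. by move=> oV oW; exists (V `*` W) => //; exact: open_setX. Qed.

Lemma open_prod_box (X Y : topologicalType) (P : set (X * Y)) x y :
  open P -> P (x, y) -> exists V W,
    [/\ open V, open W, V x, W y & V `*` W `<=` P].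
Proof.
move=> oP Pxy; have [[V' W'] /= [nV nW] VWP] := open_nbhs_nbhs (conj oP Pxy).
move: nV nW; rewrite !nbhsE => -[V [oV Vx] VV'] [W [oW Wy] WW'].
exists V, W; split=> // -[x' y'] [Vx' Wy']; apply: VWP.
by split; [apply: VV'|apply: WW'].
Qed.

Lemma sd_nbhs_box (p : S) (a : A (val p).1) (U : set (tot E)) : open U ->
  U (sdPt a) -> exists V W, [/\ open V, open W, V (Pt a), W (val p).2 &
    forall (q : S) (b : A (val q).1), V (Pt b) -> W (val q).2 -> U (sdPt b)].
Proof.
move=> [P oP <-] Pa; have [V [W [oV oW Va Wp VWP]]] := open_prod_box oP Pa.
by exists V, W; split=> // q b Vb Wq; apply: VWP.
Qed.

Lemma sd_base_nbhs_box (p : S) (U : set S) : open U -> U p -> exists V W,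
  [/\ open V, open W, V (val p).1, W (val p).2 &
    forall q : S, V (val q).1 -> W (val q).2 -> U q].
Proof.
move=> [P oP <-] /= Pp; rewrite [set_val p]surjective_pairing in Pp.
have [V [W [oV oW Vp Wp VWP]]] := open_prod_box oP Pp.
exists V, W; split=> // q Vq Wq.
by rewrite [set_val q]surjective_pairing; apply: VWP.
Qed.

(** On a box V x W the image is the box of the image of V and of W, cut down to
    the arrows of the semidirect product. *)
Lemma sd_proj_open (I : set (tot A)) (U : set (tot E)) :
  (forall V, open V -> open [set base a | a in V `&` I]) -> open U ->
  open [set base t | t in U `&` semidirect_ideal beta I].
Proof.
move=> Iop oU; rewrite openE => _ [[p a] [Ua Ia] <-] /=.
have [V [W [oV oW Va Wp VWU]]] := sd_nbhs_box oU Ua.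
have o := sd_base_box_open (Iop V oV) oW.
apply: (filterS _ (open_nbhs_nbhs (conj o _))); last first.
  by split=> //; exists (Pt (a : A (val p).1)).
move=> q [[[h b] [Vb Ib] /= hq] Wq]; subst h.
by exists (sdPt b) => //; split=> //; apply: VWU.
Qed.

(** In the relative topology of A x G a basic neighbourhood is a box, and each
    axiom reduces to the one for A, the second component being carried along. *)
Lemma sd_banach_bundle : banach_bundle_on [set: tot E].
Proof.
split=> //.
- apply: continuous_subspaceT; apply/continuous_openP => -[p a] U oU Up.
  have [V [W [oV oW Vp Wp VWU]]] := sd_base_nbhs_box oU Up.
  have /continuousP/(_ _ oV) oV' := proj_continuous bbA.
  have o := sd_box_open oV' oW.
  exists [set t : tot E | (@base _ _ @^-1` V) (sd_emb t).1 /\ W (sd_emb t).2].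
  by split=> // -[q b] [Vq Wq]; apply: VWU.
- move=> U oU; have := @sd_proj_open setT U _ oU.
  rewrite (_ : semidirect_ideal beta setT = setT)//; apply=> V oV.
  exact: (@bb_proj_open _ _ _ _ bbA V).
- by move=> p; exists (@Pt _ _ E p 0).
- move=> e; apply: open_subspaceW.
  have := sd_box_open (norm_usc bbA e) openT.
  by congr open; apply/seteqP; split=> [t []|t].
- apply: continuous_subspaceT.
  apply/continuous_prodset_openP => -[[[p a] [q b]] m] U oU.
  have epq : p = q by exact: (set_mem m).
  subst q.
  rewrite (@taddE _ _ E p a b)// => Uab.
  have [V [W [oV oW Vab Wp VWU]]] := sd_nbhs_box oU Uab.
  have [V1 [V2 [oV1 oV2 V1a V2b V12]]] :=
    add_nbhs bbA (a := a : A (val p).1) (b := b : A (val p).1) oV Vab.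
  exists [set t : tot E | V1 (sd_emb t).1 /\ W (sd_emb t).2].
  exists [set t : tot E | V2 (sd_emb t).1 /\ W (sd_emb t).2].
  split; [exact: sd_box_open|exact: sd_box_open|by []|by []|].
  move=> [[[q c] [r d]] m'] [V1c Wq] [V2d _].
  have eqr : q = r by exact: (set_mem m').
  subst r; rewrite (@taddE _ _ E q c d)//; apply: VWU => //; exact: V12.
- move=> k; apply: continuous_subspaceT.
  apply/continuous_openP => -[p a] U oU Ua.
  have [V [W [oV oW Va Wp VWU]]] := sd_nbhs_box oU Ua.
  have /continuous_openP/(_ (Pt (a : A (val p).1)) V oV Va)[V' [oV' V'a V'V]] :=
    @scale_continuous _ _ _ bbA k.
  exists [set t : tot E | V' (sd_emb t).1 /\ W (sd_emb t).2].
  split; [exact: sd_box_open|by []|].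
  by move=> [q b] [Vb Wq]; apply: VWU => //; apply: V'V Vb.
- move=> F p PF _ Fp F0 U; rewrite nbhsE => -[U' [oU' U'p] U'U].
  have [V [W [oV oW Vp Wp VWU]]] := sd_nbhs_box oU' U'p.
  have FV : F [set t : tot E | V (sd_emb t).1].
    have PF' : ProperFilter ((fun t : tot E => (sd_emb t).1) @ F).
      exact: fmap_proper_filter.
    have := @bb_norm0 _ _ _ _ bbA _ (val p).1 PF' filterT; apply.
    + move=> Q; rewrite nbhsE => -[Q' [oQ' Q'p] Q'Q].
      have := Fp _ (open_nbhs_nbhs
        (conj (sd_base_box_open oQ' openT) (conj Q'p I))).
      by apply: (@filterS _ F) => -[q b] [/= /Q'Q].
    + by move=> e e0; exact: F0 e e0.
    + by apply: open_nbhs_nbhs.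
  have FW : F [set t : tot E | W (sd_emb t).2].
    have := Fp _ (open_nbhs_nbhs
      (conj (sd_base_box_open openT oW) (conj I Wp))).
    by apply: (@filterS _ F) => -[q b] [].
  apply: (filterS _ (filterI FV FW)) => -[q b] [Vb Wq].
  by apply: U'U; apply: VWU.
Qed.

End semidirect_topology.

(** * Invariant ideals and ideals of the semidirect product *)

(** Meets and joins are determined by inclusion, so a bijection that preserves
    and reflects inclusion carries them, and their existence, across. *)
Lemma order_iso_lattice (T U : Type) (P : set (set T)) (Q : set (set U))
    (f : set T -> set U) :
  is_lattice P -> (forall X, P X -> Q (f X)) ->
  (forall Y, Q Y -> exists2 X, P X & Y = f X) ->
  (forall X Y, f X `<=` f Y <-> X `<=` Y) ->
  lattice_isomorphism P Q f.
Proof.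
move=> lP fPQ fonto fle.
have fmeet X Y M : P X -> P Y -> is_meet P X Y M -> is_meet Q (f X) (f Y) (f M).
  move=> PX PY [PM MX MY Mmax]; split; [exact: fPQ|exact/fle|exact/fle|].
  by move=> _ /fonto[N PN ->] /fle NX /fle NY; apply/fle; apply: Mmax.
have fjoin X Y M : P X -> P Y -> is_join P X Y M -> is_join Q (f X) (f Y) (f M).
  move=> PX PY [PM MX MY Mmin]; split; [exact: fPQ|exact/fle|exact/fle|].
  by move=> _ /fonto[N PN ->] /fle NX /fle NY; apply/fle; apply: Mmin.
split=> //.
- move=> _ _ /fonto[X PX ->] /fonto[Y PY ->].
  have [[M hM] [N hN]] := lP X Y PX PY.
  by split; [exists (f M); apply: fmeet|exists (f N); apply: fjoin].
- split=> //.
    move=> X Y _ _ XY.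
    by apply/seteqP; split; apply/fle; rewrite XY; exact: subset_refl.
  by move=> Y /fonto[X PX ->]; exists X.
Qed.

Section fell_action.
Variables (R : realType) (G H : groupoid) (alpha : iso_action G H).
Variables (A : fell R H) (beta : fell_action alpha A).

Lemma fact_eq x x' h k (c : acts alpha x h k) (c' : acts alpha x' h k)
    (a : A h) : x = x' -> fact beta c a = fact beta c' a.
Proof. by move=> ex; subst x'; rewrite (Prop_irrelevance c c'). Qed.

Lemma fact_unit x h (c : acts alpha x h h) (a : A h) : x = rho alpha h ->
  fact beta c a = a.
Proof. by move=> ex; subst x; exact: fact1. Qed.

Lemma factVK x h k (c : acts alpha x h k) (c' : acts alpha (ginv x) k h)
    (a : A k) : fact beta c (fact beta c' a) = a.
Proof.
have ck : rng x = rho alpha k by rewrite (rho_acts c).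
rewrite -(factM beta (gprod_V x) c' c (acts1 ck)).
exact: fact_unit.
Qed.

Lemma G_invariantP (I : set (tot A)) : G_invariant beta I <->
  forall x h k (c : acts alpha x h k) (a : A h),
    I (Pt a) -> I (Pt (fact beta c a)).
Proof.
split=> h; last by move=> [[x [l a]] m] /= Ia; exact: h.
move=> x l k [e ek] a Ia; subst k.
have m : (x, Pt a) \in @tact_domain R G H alpha A by exact/mem_set.
pose q : @tact_domain R G H alpha A := exist _ (x, Pt a) m.
have := h q Ia; rewrite /tact /tact_map.
by rewrite (Prop_irrelevance (set_valP q) e).
Qed.

Hypothesis fbA : fell_bundle A.

(** The meet and the join are those of all ideals: both constructions preserve
    invariance, as G acts by linear isometries of the fibres. *)
Lemma invariant_ideals_lattice : continuous (@src H) ->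
  is_lattice (invariant_ideal beta).
Proof.
move=> csrc I J [idI invI] [idJ invJ]; split.
  exists (I `&` J); split.
  - split; first exact: (ideal_meet fbA).
    by move=> xa [Ia Ja]; split; [apply: invI|apply: invJ].
  - by move=> a [].
  - by move=> a [].
  - by move=> K _ KI KJ a Ka; split; [apply: KI|apply: KJ].
exists (closed_sum I J); split.
- split; first exact: (ideal_closed_sum fbA).
  move: invI invJ => /G_invariantP invI /G_invariantP invJ.
  apply/G_invariantP => x h k c; apply: closed_sum_transport.
  + by move=> a b; have := fact_linear beta c 1 a b; rewrite !scale1r.
  + by exists 1 => // a; rewrite fact_norm mul1r.
  + by move=> i; exact: invI.
  + by move=> j; exact: invJ.
- exact: closed_sum_subl.
- exact: closed_sum_subr.
- by move=> K [idK _]; exact: closed_sum_min.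
Qed.

Local Notation S := (semidirect alpha).
Local Notation E := (semidirect_fell beta).
Let bbA := fb_banach fbA.

Lemma semidirect_ideal_ideal (I : set (tot A)) : invariant_ideal beta I ->
  ideal (semidirect_ideal beta I).
Proof.
move=> [idI /G_invariantP inv]; apply: ideal_intro.
- exact: sd_banach_bundle.
- by move=> p; exact: (ideal0 idI (val p).1).
- by move=> p k a b; exact: (@ideal_linear _ _ _ _ idI (val p).1).
- move=> p.
  exact: (@bb_closed _ _ _ _ (fs_banach (id_subbundle idI)) (val p).1).
- by move=> U; apply: sd_proj_open => V; exact: ideal_proj_open.
- move=> p q t c a b Iab; apply: (ideal_mul idI).
  by case: Iab => ?; [left|right; exact: inv].
- by move=> p a Ia; apply: inv; exact: (ideal_star idI).
Qed.

Lemma gprod_left_divisor (K : groupoid) (x z : K) : rng x = rng z ->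
  exists y, gprod x y z.
Proof.
move=> xz; have e : src (ginv x) = rng z by rewrite src_inv.
have cy : gprod (ginv x) z (gmul e) by exists e.
exists (gmul e); apply: gprodA (gprod_V x) cy _.
by rewrite xz; exact: gprod_l.
Qed.

Lemma rho_eq_units (h : H) : rho alpha h = rng (rho alpha h).
Proof. by rewrite (rho_units alpha h). Qed.

(** A product over units of G in the semidirect product is a product in A; the
    arrow y' equals y, but only provably so. *)
Lemma fmul_fact_unit u x y y' z (c : gprod x y z) (cu : acts alpha u y y')
    (c' : gprod x y' z) (a : A x) (b : A y) : u = rho alpha y ->
  fmul c' a (fact beta cu b) = fmul c a b.
Proof.
move=> uy; have ey := acts_fun (acts1 uy) cu; subst y'.
by rewrite (Prop_irrelevance c' c) fact_unit.
Qed.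

Definition sd_unit (h : H) : S := sd_mk (rho_eq_units h).

(** The part of J over the units of G, seen in A. *)
Definition slice (J : set (tot E)) : set (tot A) :=
  [set a | J (@sdPt _ _ _ _ _ beta (sd_unit (base a)) (vec a))].

Section slice.
Variable J : set (tot E).
Hypothesis idJ : ideal J.

(** Since p and q have the same range, q = p s for some arrow s, whose first
    component is moved by p to a unit of H.  The vectors over s are carried by
    the action onto the whole fibre of A over that unit, so J contains, over q,
    all products a b with b in that fibre.  These approximate a. *)
Lemma ideal_change_arrow (p q : S) (e : (val p).1 = (val q).1)
    (a : A (val p).1) : J (sdPt beta a) -> J (sdPt beta (ecast h (A h) e a)).
Proof.
case: p q e a => [[h x] m] [[k y] m'] /= e; subst k => a /= Ja.
pose p : sd_set alpha := exist _ (h, x) m.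
pose q : sd_set alpha := exist _ (h, y) m'.
have pq : @rng S p = @rng S q.
  by apply: sd_eq => //=; rewrite -(set_mem m) -(set_mem m').
have [s c] := gprod_left_divisor pq.
apply: (ideal_approx idJ (x := q)) => d d0.
have [b _ ab] := bundle_local_unit fbA (sd_comp c : gprod h _ h) a d0.
have fb := factVK (act_acts (sd_comp_act c))
  (actsV (act_acts (sd_comp_act c))) b.
exists (fmul (sd_comp c : gprod h _ h) a b) => //.
rewrite -fb; apply: (ideal_mul idJ c); left.
exact: Ja.
Qed.

Lemma sliceP (p : S) (a : A (val p).1) : J (sdPt beta a) <-> slice J (Pt a).
Proof.
split=> [Ja|Ja].
  exact: (@ideal_change_arrow p (sd_unit (val p).1) erefl).
exact: (@ideal_change_arrow (sd_unit (val p).1) p erefl).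
Qed.

Lemma sd_unit_prod (x y z : H) : gprod x y z ->
  @gprod S (sd_unit x) (sd_unit y) (sd_unit z).
Proof.
move=> c; have [exy _] := c.
have rxy : rho alpha x = rho alpha y by rewrite -rho_src exy rho_rng.
have rz := rho_comp alpha c.
have e : @src S (sd_unit x) = @rng S (sd_unit y).
  apply: sd_eq; last first.
    by rewrite /= -rho_eq_units -rxy {1}rho_eq_units src_rng -rho_eq_units.
  by apply: sd_srcE; rewrite /= exy; apply: acts1; rewrite rho_rng.
exists e; apply: sd_eq.
  have cy : acts alpha (val (sd_unit x)).2 (val (sd_unit y)).1 y.
    exact: acts1.
  exact: gprod_fun (sd_srcP e cy) c.
apply: gprod_fun (sd_mul2 e) _; rewrite /= -rxy rz.
exact: gprod_unit (rho_units alpha x).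
Qed.

Lemma slice_mul x y z (c : gprod x y z) (a : A x) (b : A y) :
  slice J (Pt a) \/ slice J (Pt b) -> slice J (Pt (fmul c a b)).
Proof.
move=> Jab; have c' := sd_unit_prod c.
have rxy : rho alpha x = rho alpha y.
  by have [e _] := c; rewrite -rho_src e rho_rng.
have <- : sd_fmul beta c' a b = fmul c a b by exact: fmul_fact_unit rxy.
exact: (ideal_mul idJ c').
Qed.

Lemma sd_unit_inv (x : H) : @ginv S (sd_unit x) = sd_unit (ginv x).
Proof.
have u : ginv (rho alpha x) = rho alpha x by apply/inv_unit/rho_units.
apply: sd_eq; last by rewrite /= rho_inv.
apply: acts_fun (act_acts _) _; apply: acts1.
by rewrite /= u rho_inv.
Qed.

Lemma slice_star x (a : A x) :
  slice J (Pt a) -> slice J (Pt (fstar (erefl (ginv x)) a)).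
Proof.
move=> Ja; have := ideal_star idJ (sd_unit_inv x) Ja.
rewrite /slice /= /sdPt; congr J; congr Pt.
rewrite [LHS]/= /sd_fstar; apply: fact_unit => /=.
by rewrite rho_inv; apply/inv_unit/rho_units.
Qed.

(** The image is the preimage, under the section h |-> (h, rho h) of the first
    projection, of the image of an open part of J. *)
Lemma slice_proj_open (U : set (tot A)) : open U ->
  open [set base a | a in U `&` slice J].
Proof.
move=> oU; have oU' := sd_box_open beta oU (@openT G).
rewrite openE => _ [[h a] [Ua Ja] <-] /=.
have [|V [W [oV oW Vh Wh VWO]]] := @sd_base_nbhs_box _ _ _ (sd_unit h) _
    (ideal_proj_open idJ oU').
  by exists (sdPt beta (a : A (val (sd_unit h)).1)).
have /continuousP/(_ _ oW) oW' := rho_continuous (i := alpha).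
apply: (filterS _ (open_nbhs_nbhs (conj (openI oV oW') (conj Vh Wh)))).
move=> k [Vk Wk]; have [[p b] [[Ub _] Jb] /= pk] := VWO (sd_unit k) Vk Wk.
by subst p; exists (Pt (b : A k)).
Qed.

Lemma slice_ideal : ideal (slice J).
Proof.
apply: ideal_intro => //.
- by move=> h; exact: (ideal0 idJ (sd_unit h)).
- by move=> h; exact: (@ideal_linear _ _ _ _ idJ (sd_unit h)).
- move=> h.
  exact: (@bb_closed _ _ _ _ (fs_banach (id_subbundle idJ)) (sd_unit h)).
- exact: slice_proj_open.
- exact: slice_mul.
- exact: slice_star.
Qed.

(** The adjoint of (a, x^-1) is (x . a^*, x).  As the second component may be
    changed at will, a in the slice gives x . a^* in the slice, hence also its
    adjoint x . a. *)
Lemma slice_invariant : G_invariant beta (slice J).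
Proof.
apply/G_invariantP => x h k c a Ja.
have e : rho alpha h = rng (ginv x) by rewrite rng_inv; case: c => e _.
have := (@sliceP (sd_mk e) a).2 Ja.
move=> /(ideal_star idJ (erefl (ginv (sd_mk e : S)))) /sliceP.
rewrite [fstar _ _]/(sd_fstar beta _ _) /sd_fstar; set c1 := sd_inv_actsV _.
have c2 : acts alpha (ginv (ginv x)) h k by rewrite ginvK.
have ek : ginv (val (ginv (sd_mk e : S))).1 = k.
  by apply: acts_fun c2; have := acts_inv c1; rewrite [ginv (ginv _)]ginvK.
move=> /(ideal_star slice_ideal ek).
rewrite (fact_star beta (ginvK h) ek c1 c2) (fb_starK fbA).
by rewrite (fact_eq c c2)// ginvK.
Qed.

Lemma semidirect_slice : J = semidirect_ideal beta (slice J).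
Proof. by apply/seteqP; split=> -[p a] /(@sliceP p a). Qed.

End slice.

(** Each vector of A occurs in the semidirect product, over a unit of G. *)
Lemma semidirect_ideal_subset (I I' : set (tot A)) :
  semidirect_ideal beta I `<=` semidirect_ideal beta I' <-> I `<=` I'.
Proof.
split=> II'; last by move=> t; exact: II'.
by move=> [h a] Ia; exact: (II' (sdPt beta (a : A (val (sd_unit h)).1)) Ia).
Qed.

End fell_action.

Theorem theorem5p1 (R : realType) (G H : groupoid)
    (lchG : lch_groupoid G) (lchH : lch_groupoid H)
    (A : fell R H) (fellA : fell_bundle A)
    (alpha : iso_action G H) (beta : fell_action alpha A) :
  (forall J : set (tot (semidirect_fell beta)), ideal J ->
     exists2 I : set (tot A),
       ideal I /\ G_invariant beta I & J = semidirect_ideal beta I) /\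
  lattice_isomorphism (invariant_ideal beta)
    [set J : set (tot (semidirect_fell beta)) | ideal J]
    (semidirect_ideal beta).
Proof.
have onto J : ideal J -> exists2 I : set (tot A),
    ideal I /\ G_invariant beta I & J = semidirect_ideal beta I.
  move=> idJ; exists (slice J); last exact: semidirect_slice.
  by split; [exact: slice_ideal|exact: slice_invariant].
split=> //; apply: order_iso_lattice => //.
- by apply: invariant_ideals_lattice => //; exact: lch_src lchH.
- by move=> I; exact: semidirect_ideal_ideal.
- by move=> I I'; exact: semidirect_ideal_subset.
Qed.
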